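(* Let $T$ be a complete first-order NIP theory with monster model $\mathfrak{C}$, and let $E$ be a $\emptyset$-type-definable equivalence relation on $\mathfrak{C}^\lambda$ for a small cardinal $\lambda$. If $(a_i)_{i\in\mathcal{I}}$ is a dense distal indiscernible sequence of tuples from $\mathfrak{C}^\lambda$, then $(a_i/E)_{i\in\mathcal{I}}$ is a distal sequence of hyperimaginaries. Consequently, if $T$ is distal, then $T^{\mathrm{heq}}$ is distal.
   Context: $\mathfrak{C}$ is $\kappa$-saturated and strongly $\kappa$-homogeneous for a strong limit $\kappa>|T|$. Hyperimaginaries are classes $a/E$ of $\emptyset$-type-definable equivalence relations; their types over a set are orbits under automorphisms fixing that set, and indiscernibility of sequences of hyperimaginaries is defined via these types. For an indiscernible sequence $I$ (of tuples or of hyperimaginaries) indexed by a dense linear order, a cut is a decomposition $I=I_1+I_2$ (concatenation); it is Dedekind if $I_1$ and $I_2$ with reversed order both have infinite cofinality; an element $b$ (of the same sort) fills the cut if $I_1+b+I_2$ is indiscernible. A dense indiscernible sequence $I$ is distal if for any two distinct Dedekind cuts $\mathfrak{c}_1=(I_1, I_2+I_3)$ and $\mathfrak{c}_2=(I_1+I_2,I_3)$, whenever $a$ fills $\mathfrak{c}_1$ and $b$ fills $\mathfrak{c}_2$, the sequence $I_1+a+I_2+b+I_3$ is indiscernible. $T$ is distal if all dense indiscernible sequences of tuples are distal; $T^{\mathrm{heq}}$ is distal if all dense indiscernible sequences $(a_i/E)_{i\in\mathcal{I}}$ of hyperimaginaries, with $E$ a $\emptyset$-type-definable equivalence relation, are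 distal. *)

(* Defs.v *)
From mathcomp Require Import all_boot all_order.
From mathcomp Require Import all_classical.

Set Implicit Arguments.
Unset Strict Implicit.
Unset Printing Implicit Defensive.

Local Open Scope classical_set_scope.
Local Open Scope card_scope.

Record language := Language {
  fsym : Type;
  far : fsym -> nat;
  rsym : Type;
  rar : rsym -> nat
}.

Section Syntax.
Variable L : language.

Inductive term (V : Type) : Type :=
| Var of V
| App (f : fsym L) of ('I_(far f) -> term V).

(* [formula V] is the type of formulas with free variables in [V]; a
   quantifier binds the variable [None] of [option V]. *)
Inductive formula (V : Type) : Type :=
| Bot
| Eqn of term V & term V
| Rel (r : rsym L) of ('I_(rar r) -> term V)
| Imp of formula V & formula V
| All of formula (option V).

Definition Neg (V : Type) (p : formula V) : formula V := Imp p (Bot V).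

Definition sentence := formula void.

Record structure := Structure {
  dom :> Type;
  dom_inhabited : inhabited dom;
  finterp : forall f : fsym L, ('I_(far f) -> dom) -> dom;
  rinterp : forall r : rsym L, ('I_(rar r) -> dom) -> Prop
}.

Definition extend (A V : Type) (e : V -> A) (x : A) (v : option V) : A :=
  if v is Some w then e w else x.

Fixpoint eval (M : structure) (V : Type) (e : V -> M) (t : term V) : M :=
  match t with
  | Var v => e v
  | App f ts => finterp (fun k => eval e (ts k))
  end.

Fixpoint sat (M : structure) (V : Type) (p : formula V) (e : V -> M) : Prop :=
  match p with
  | Bot => False
  | Eqn t u => eval e t = eval e u
  | Rel r ts => rinterp (fun k => eval e (ts k))
  | Imp q r => sat q e -> sat r e
  | All q => forall x : M, sat q (extend e x)
  end.

Definition theory := set sentence.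

Definition models (M : structure) (T : theory) :=
  forall p, T p -> sat p (of_void M).

Definition entails (T : theory) (p : sentence) :=
  forall M : structure, models M T -> sat p (of_void M).

Definition complete (T : theory) :=
  (exists M : structure, models M T) /\
  (forall p, entails T p \/ entails T (Neg p)).

Definition pair_env (A V W : Type) (a : V -> A) (b : W -> A) (v : V + W) : A :=
  match v with inl x => a x | inr y => b y end.

Definition has_IP (M : structure) m n (p : formula ('I_m + 'I_n)) :=
  exists (a : nat -> 'I_m -> M) (b : set nat -> 'I_n -> M),
    forall k S, sat p (pair_env (a k) (b S)) <-> S k.

Definition NIP (T : theory) :=
  forall M : structure, models M T ->
  forall m n (p : formula ('I_m + 'I_n)), ~ has_IP M p.

Definition same_type (M : structure) (V : Type) (a b : V -> M) :=
  forall p : formula V, sat p a <-> sat p b.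

Definition automorphism (M : structure) (s : M -> M) :=
  [/\ bijective s,
      forall (f : fsym L) (x : 'I_(far f) -> M),
        s (finterp x) = finterp (s \o x)
    & forall (r : rsym L) (x : 'I_(rar r) -> M),
        rinterp x <-> rinterp (s \o x)].

(* Cardinals are represented by types. *)
Definition small (K : Type) (X : Type) (A : set X) :=
  A #<= [set: K] /\ ~ ([set: K] #<= A).

Definition strong_limit (K : Type) :=
  forall A : set K, small K A -> small K [set B : set K | B `<=` A].

Definition saturated (K : Type) (M : structure) :=
  forall A : set M, small K A ->
  forall p : set (formula (option A)),
    (forall q, q `<=` p -> finite_set q ->
       exists x : M, forall f, q f -> sat f (extend val x)) ->
    exists x : M, forall f, p f -> sat f (extend val x).

Definition strongly_homogeneous (K : Type) (M : structure) :=
  forall A : set M, small K A ->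
  forall g : A -> M, same_type val g ->
    exists2 s : M -> M, automorphism s & forall x : A, s (val x) = g x.

(* |T| is by convention the number of L-formulas (in countably many
   variables), i.e. |L| + aleph_0. *)
Definition monster (T : theory) (K : Type) (M : structure) :=
  [/\ strong_limit K,
      small K [set: formula nat],
      models M T,
      saturated K M
    & strongly_homogeneous K M].

End Syntax.

Record oseq (S : Type) := OSeq {
  idx : Type;
  olt : idx -> idx -> Prop;
  nthi : idx -> S
}.

Section Sequences.
Variable S : Type.
Implicit Types s t : oseq S.

Definition oseq_of (d : Order.disp_t) (I : orderType d) (a : I -> S) : oseq S :=
  OSeq (fun x y : I => (x < y)%O) a.

Definition orestr s (D : set (idx s)) : oseq S :=
  @OSeq S D (fun x y => olt (val x) (val y)) (fun x => nthi (val x)).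

Definition osingle (b : S) : oseq S :=
  OSeq (fun _ _ : unit => False) (fun _ => b).

Definition ocat s t : oseq S :=
  @OSeq S (idx s + idx t)
    (fun x y => match x, y with
                | inl i, inl j => olt i j
                | inr i, inr j => olt i j
                | inl _, inr _ => True
                | inr _, inl _ => False
                end)
    (fun x => match x with inl i => nthi i | inr j => nthi j end).

Definition orev s : oseq S := OSeq (fun x y => olt y x) (@nthi S s).

Definition infinite_cofinality s :=
  forall A : set (idx s),
    (forall x, exists2 y, A y & olt x y \/ x = y) -> infinite_set A.

Definition initial_segment s (D : set (idx s)) :=
  forall x y, D y -> olt x y -> D x.

(* The cut (I_1, I_2) of s is given by the set D of indices of I_1. *)
Definition dedekind_cut s (D : set (idx s)) :=
  [/\ initial_segment D,
      infinite_cofinality (orestr D)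
    & infinite_cofinality (orev (orestr (~` D)))].

Definition increasing s n (i : 'I_n -> idx s) :=
  forall j k : 'I_n, (j < k)%N -> olt (i j) (i k).

Definition fills (indisc : oseq S -> Prop) s (D : set (idx s)) (b : S) :=
  indisc (ocat (orestr D) (ocat (osingle b) (orestr (~` D)))).

(* For cuts D1 and D2 of I with D1 a proper subset of D2, the pieces are
   I_1 = D1, I_2 = D2 \ D1 and I_3 = ~ D2. *)
Definition distal_seq (indisc : oseq S -> Prop) s :=
  indisc s /\
  forall D1 D2 : set (idx s),
    dedekind_cut D1 -> dedekind_cut D2 -> D1 `<` D2 ->
    forall a b : S, fills indisc D1 a -> fills indisc D2 b ->
      indisc (ocat (orestr D1) (ocat (osingle a)
             (ocat (orestr (D2 `\` D1)) (ocat (osingle b)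
                   (orestr (~` D2)))))).

End Sequences.

Definition dense_order (d : Order.disp_t) (I : orderType d) :=
  forall x y : I, (x < y)%O -> exists z : I, (x < z < y)%O.

Section Distality.
Variables (L : language) (M : structure L).

Definition indiscernible (Lam : Type) (s : oseq (Lam -> M)) :=
  forall n (i j : 'I_n -> idx s), increasing i -> increasing j ->
    same_type (fun v : 'I_n * Lam => nthi (i v.1) v.2)
              (fun v : 'I_n * Lam => nthi (j v.1) v.2).

Definition type_definable (Lam : Type) (E : (Lam -> M) -> (Lam -> M) -> Prop) :=
  exists F : set (formula L (Lam + Lam)),
    forall a b, E a b <-> (forall p, F p -> sat p (pair_env a b)).

Definition type_definable_equivalence (Lam : Type)
    (E : (Lam -> M) -> (Lam -> M) -> Prop) :=
  RelationClasses.Equivalence E /\ type_definable E.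

Record hyperimaginary (Lam : Type) (E : (Lam -> M) -> (Lam -> M) -> Prop) :=
  Hyperimaginary {
    hclass :> set (Lam -> M);
    hclassP : exists a, hclass = [set b | E a b]
  }.

Definition hyper (Lam : Type) (E : (Lam -> M) -> (Lam -> M) -> Prop)
    (a : Lam -> M) : hyperimaginary E :=
  @Hyperimaginary Lam E [set b | E a b] (ex_intro _ a erefl).

(* Families of hyperimaginaries have the same type over A when they are
   conjugate under the action of Aut(M/A) on E-classes. *)
Definition same_htype (Lam : Type) (E : (Lam -> M) -> (Lam -> M) -> Prop)
    (A : set M) (J : Type) (g h : J -> hyperimaginary E) :=
  exists s : M -> M,
    [/\ automorphism s,
        forall x, A x -> s x = x
      & forall j, (fun a : Lam -> M => s \o a) @` (g j) = h j :> set (Lam -> M)].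

Definition hindiscernible (Lam : Type) (E : (Lam -> M) -> (Lam -> M) -> Prop)
    (s : oseq (hyperimaginary E)) :=
  forall n (i j : 'I_n -> idx s), increasing i -> increasing j ->
    same_htype set0 (fun k => nthi (i k)) (fun k => nthi (j k)).

Definition distal_theory (K : Type) :=
  forall (Lam : Type), small K [set: Lam] ->
  forall (d : Order.disp_t) (I : orderType d) (a : I -> Lam -> M),
    small K [set: I] -> dense_order I -> indiscernible (oseq_of a) ->
    distal_seq (@indiscernible Lam) (oseq_of a).

Definition heq_distal (K : Type) :=
  forall (Lam : Type) (E : (Lam -> M) -> (Lam -> M) -> Prop),
    small K [set: Lam] -> type_definable_equivalence E ->
  forall (d : Order.disp_t) (I : orderType d) (h : I -> hyperimaginary E),
    small K [set: I] -> dense_order I -> hindiscernible (oseq_of h) ->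
    distal_seq (@hindiscernible Lam E) (oseq_of h).

End Distality.

(* Main.v *)
(* Call a tuple of hyperimaginaries good if it is conjugate to an increasing
   tuple of (a_i/E); goodness is a type-definable condition on representatives.
   If (a_i/E) is not distal, there are alpha and beta, each of which can be
   inserted into (a_i/E) at its own cut, but not both together.  In real
   representatives, distality of (a_i) says that a lift of (a_i/E) never admits
   both a lift of alpha and a lift of beta, although it may admit either one.

   Base change: if inserting further failing pairs always violated a given
   formula at one of the two points, the violating points could be inserted one
   after the other, and any lift of the resulting good sequence would alternate
   too often with respect to that formula.  Hence there are failing pairs
   (alpha_n, beta_n), n < N, such that for every set S the sequence containing
   alpha_n for n in S and beta_n for n not in S is good.  By distality a lift of
   this sequence admits a lift of alpha_n exactly when n is in S, and by
   compactness a formula witnesses this: the theory has the independence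
   property.

   For the second assertion, Ramsey's theorem and compactness lift an
   indiscernible sequence of hyperimaginaries to one of representatives. *)

From Stdlib Require List.
Require Import Defs.
From mathcomp Require Import all_boot all_order.
From mathcomp Require Import all_classical.
Import Order.TTheory.

Set Implicit Arguments.
Unset Strict Implicit.
Unset Printing Implicit Defensive.

Local Open Scope classical_set_scope.
Local Open Scope card_scope.

(** * Formulas and definable sets *)

(** The obstacle is that automorphisms respecting the classes [a_i/E] still move representatives. A
    lift of alpha and a lift of beta may each fit into some lift of the sequence without, a priori,
    fitting into a common one, so distality of (a_i) does not apply directly. Compactness over the
    fixed representatives first cuts the failure down to finitely many indices; those left of,
    between and right of the two cuts become parameters shared by all failing pairs. That a point
    fits at a cut is only type-definable, whereas NIP bounds the alternation of a formula. Each such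
    condition is therefore enlarged to a formula before anything is counted. The bound depends on
    the formula and not on its parameters, so the number of points to keep in reserve is known
    before the parameters are chosen. Infinite sequences are replaced throughout by finite
    increasing lists: good lists of one length form a single orbit up to [E]. This makes goodness
    type-definable and lets a picture found in (a_i) be transported to any good list. *)

Lemma In_pmap (X Y : Type) (f : X -> option Y) (s : seq X) x y :
  List.In x s -> f x = Some y -> List.In y (pmap f s).
Proof.
move=> + fxy; elim: s => //= z s IH [->|/IH]; first by rewrite fxy; left.
by case: (f z) => //= w; right.
Qed.

Section FirstOrder.
Variables (L : language) (M : structure L).

Fixpoint rename_term (V W : Type) (r : V -> W) (t : term L V) : term L W :=
  match t with
  | Var v => Var L (r v)
  | App f ts => App (fun k => rename_term r (ts k))
  end.

Fixpoint rename (V W : Type) (r : V -> W) (p : formula L V) : formula L W :=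
  match p with
  | Bot => Bot L W
  | Eqn t u => Eqn (rename_term r t) (rename_term r u)
  | Rel s ts => Rel (fun k => rename_term r (ts k))
  | Imp q s => Imp (rename r q) (rename r s)
  | All q => All (rename (omap r) q)
  end.

Lemma eval_rename (V W : Type) (r : V -> W) (t : term L V) (e : W -> M) :
  eval e (rename_term r t) = eval (e \o r) t.
Proof.
by elim: t => //= f ts IH; congr finterp; apply/funext => k; exact: IH.
Qed.

Lemma sat_rename (V W : Type) (r : V -> W) (p : formula L V) (e : W -> M) :
  sat (rename r p) e <-> sat p (e \o r).
Proof.
elim: p W r e => {V} [V|V t u|V s ts|V q IHq s IHs|V q IHq] W r e //=.
- by rewrite !eval_rename.
- have -> : (fun k => eval e (rename_term r (ts k))) =
            (fun k => eval (e \o r) (ts k)).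
    by apply/funext => k; rewrite eval_rename.
  by [].
- by split=> H /IHq /H /IHs.
- have E x : extend e x \o omap r = extend (e \o r) x.
    by apply/funext; case.
  by split=> H x; have := H x; rewrite IHq E.
Qed.

Lemma eval_support (V : Type) (t : term L V) : exists s : seq V,
  forall e e' : V -> M, (forall v, List.In v s -> e v = e' v) ->
  eval e t = eval e' t.
Proof.
elim: t => [v|f ts IH]; first by exists [:: v] => e e' /= -> //; left.
have /choice[s Hs] := IH.
exists (flatten [seq s k | k <- enum 'I_(far f)]) => e e' He /=.
congr finterp; apply/funext => k; apply: Hs => v vk; apply: He.
have : k \in enum 'I_(far f) by rewrite mem_enum.
elim: (enum _) => //= j u IHu; rewrite inE List.in_app_iff.
by case/orP => [/eqP<-|/IHu]; [left|right].
Qed.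

Lemma sat_support (V : Type) (p : formula L V) : exists s : seq V,
  forall e e' : V -> M, (forall v, List.In v s -> e v = e' v) ->
  sat p e <-> sat p e'.
Proof.
elim: p => {V} [V|V t u|V r ts|V q [s Hs] r [s' Hs']|V q [s Hs]].
- by exists [::].
- have [s Hs] := eval_support t; have [s' Hs'] := eval_support u.
  exists (s ++ s') => e e' He /=; rewrite (Hs e e') 1?(Hs' e e') //.
    by move=> v vs; apply: He; apply/List.in_app_iff; right.
  by move=> v vs; apply: He; apply/List.in_app_iff; left.
- have /choice[s Hs] := fun k => eval_support (ts k).
  exists (flatten [seq s k | k <- enum 'I_(rar r)]) => e e' He /=.
  suff -> : (fun k => eval e (ts k)) = (fun k => eval e' (ts k)) by [].
  apply/funext => k; apply: Hs => v vk; apply: He.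
  have : k \in enum 'I_(rar r) by rewrite mem_enum.
  elim: (enum _) => //= j u IHu; rewrite inE List.in_app_iff.
  by case/orP => [/eqP<-|/IHu]; [left|right].
- exists (s ++ s') => e e' He /=; rewrite (Hs e e') 1?(Hs' e e') //.
    by move=> v vs; apply: He; apply/List.in_app_iff; right.
  by move=> v vs; apply: He; apply/List.in_app_iff; left.
- have sin v : List.In (Some v) s -> List.In v (pmap id s).
    by move=> vs; exact: In_pmap vs erefl.
  exists (pmap id s) => e e' He /=.
  have E x : sat q (extend e x) <-> sat q (extend e' x).
    by apply: Hs => -[v|] //= /sin; exact: He.
  by split=> H x; apply/E.
Qed.

(** * Closure properties of definable sets *)

Definition definable (V : Type) (D : (V -> M) -> Prop) :=
  exists p : formula L V, forall e, D e <-> sat p e.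

Lemma definable_sat (V : Type) (p : formula L V) : definable (sat p).
Proof. by exists p. Qed.

Lemma definable_ext (V : Type) (C D : (V -> M) -> Prop) :
  (forall e, C e <-> D e) -> definable D -> definable C.
Proof. by move=> H [p Hp]; exists p => e; rewrite H. Qed.

Lemma definable_not (V : Type) (D : (V -> M) -> Prop) :
  definable D -> definable (fun e => ~ D e).
Proof. by move=> [p Hp]; exists (Neg p) => e; rewrite Hp. Qed.

Lemma definable_imp (V : Type) (C D : (V -> M) -> Prop) :
  definable C -> definable D -> definable (fun e => C e -> D e).
Proof. by move=> [p Hp] [q Hq]; exists (Imp p q) => e /=; rewrite Hp Hq. Qed.

Lemma definable_and (V : Type) (C D : (V -> M) -> Prop) :
  definable C -> definable D -> definable (fun e => C e /\ D e).
Proof.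
move=> dC dD; apply: (@definable_ext _ _ (fun e => ~ (C e -> ~ D e))).
  by move=> e; split=> [[c d] /(_ c)|/not_implyP[c /contrapT]].
exact: definable_not (definable_imp dC (definable_not dD)).
Qed.

Lemma definable_true (V : Type) : definable (fun _ : V -> M => True).
Proof. by exists (Neg (Bot L V)) => e; split=> // _ []. Qed.

Lemma definable_all (V T : Type) (s : seq T) (D : T -> (V -> M) -> Prop) :
  (forall t, definable (D t)) ->
  definable (fun e => forall t, List.In t s -> D t e).
Proof.
move=> dD; elim: s => [|t s IH].
  by apply: definable_ext (definable_true V) => e; split=> // _ t [].
apply: definable_ext (definable_and (dD t) IH) => e; split=>
  [H|[H H'] u [<-//|]].
  by split=> [|u us]; apply: H; [left|right].
exact: H'.
Qed.

Lemma definable_rename (V W : Type) (r : V -> W) (D : (V -> M) -> Prop) :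
  definable D -> definable (fun e => D (e \o r)).
Proof. by move=> [p Hp]; exists (rename r p) => e; rewrite Hp sat_rename. Qed.

Lemma definable_ex1 (V : Type) (D : (option V -> M) -> Prop) :
  definable D -> definable (fun e => exists x, D (extend e x)).
Proof.
move=> dD; apply: (@definable_ext _ _ (fun e => ~ forall x, ~ D (extend e x))).
  by move=> e; split=> [[x Dx] /(_ x)//|/existsNP[x /contrapT]]; exists x.
by have [p Hp] := definable_not dD; apply: definable_not; exists (All p) => e;
  split=> H x; apply/Hp; exact: H.
Qed.

Lemma definable_ex (V : Type) (s : seq V) (D : (V -> M) -> Prop) :
  definable D -> definable (fun e => exists f : V -> M,
    (forall v, ~ List.In v s -> f v = e v) /\ D f).
Proof.
move=> dD; elim: s => [|v s IH].
  apply: definable_ext dD => e; split=> [[f [fe Df]]|De]; last by exists e.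
  by have -> : e = f by apply/funext => v; rewrite fe.
pose r (w : V) := if pselect (w = v) then None else Some w.
apply: definable_ext (definable_ex1 (definable_rename r IH)) => e; split.
- move=> [f [fe Df]]; exists (f v), f; split=> // w ws.
  rewrite /comp /r; case: pselect => /= [->//|wv].
  by apply: fe => -[/esym//|].
- move=> [x [f [fe Df]]]; exists f; split=> // w wvs.
  rewrite fe /comp /r; last by move=> ws; apply: wvs; right.
  by case: pselect => //= wv; case: wvs; left.
Qed.

(** [Q] may be infinite, but a formula depends on finitely many variables, so only those of its
    support that lie in [Q] need a quantifier. *)
Lemma definable_exP (V : Type) (Q : V -> Prop) (D : (V -> M) -> Prop) :
  definable D -> definable (fun e => exists f : V -> M,
    (forall v, ~ Q v -> f v = e v) /\ D f).
Proof.
move=> dD; have [p Hp] := dD; have [s Hs] := sat_support p.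
pose s' := [seq w <- s | `[< Q w >]].
have sin v : List.In v s' <-> List.In v s /\ Q v.
  rewrite /s'; elim: (s) => /= [|w u IH]; first by split=> // -[].
  by case: asboolP => Qw /=; rewrite IH; intuition (subst; auto).
apply: definable_ext (definable_ex s' dD) => e; split=> -[f [fe Df]].
- exists (fun v => if pselect (List.In v s') then f v else e v).
  split=> [v vs|]; first by case: pselect.
  apply/Hp/(Hs _ f)/Hp => // v vs; case: pselect => //= /sin vs'.
  by rewrite fe // => Qv; apply: vs'.
- by exists f; split=> // v Qv; apply: fe => /sin[].
Qed.

Lemma definable_proj (W V : Type) (D : (W + V -> M) -> Prop) :
  definable D -> definable (fun e => exists f, D (pair_env e f)).
Proof.
pose Q (u : W + V) := if u is inr _ then True else False.
(* The coordinates in [V] get overwritten by the quantifiers, so they all start from one dummy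
   value, bound as [None]. *)
pose r (u : W + V) := if u is inl w then Some w else None.
move=> dD.
apply: definable_ext (definable_ex1 (definable_rename r (definable_exP Q dD))).
move=> e; split=> [[f Df]|[x [f [fe Df]]]].
  have [x] := dom_inhabited M; exists x, (pair_env e f).
  by split=> // -[w _|v []].
exists (f \o inr); suff -> : pair_env e (f \o inr) = f by [].
by apply/funext => -[w|v] //=; rewrite fe.
Qed.

(** * Invariance under automorphisms *)

Section Automorphisms.
Variable s : M -> M.
Hypothesis aut_s : automorphism s.

Lemma eval_aut (V : Type) (e : V -> M) (t : term L V) :
  eval (s \o e) t = s (eval e t).
Proof.
have [_ sf _] := aut_s; elim: t => //= f ts IH; rewrite sf; congr finterp.
by apply/funext => k; rewrite IH.
Qed.

Lemma sat_aut (V : Type) (p : formula L V) (e : V -> M) :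
  sat p (s \o e) <-> sat p e.
Proof.
have [[s' sK s'K] _ sr] := aut_s.
elim: p e => {V} [V|V t u|V r ts|V q IHq r IHr|V q IHq] e //=.
- by rewrite !eval_aut; split=> [/(can_inj sK)|->].
- rewrite (_ : (fun k => _) = s \o (fun k => eval e (ts k))) -?sr //.
  by apply/funext => k; rewrite eval_aut.
- by rewrite IHq IHr.
- have E x : extend (s \o e) (s x) = s \o extend e x by apply/funext; case.
  split=> H x; first by apply/IHq; rewrite -E.
  by rewrite -(s'K x) E; apply/IHq.
Qed.
End Automorphisms.

Lemma aut_inv (s : M -> M) : automorphism s -> exists s' : M -> M,
  [/\ automorphism s', cancel s s' & cancel s' s].
Proof.
move=> [[s' sK s'K] sf sr]; exists s'; split=> //; split; first by exists s.
- move=> f x; apply: (can_inj sK); rewrite s'K sf; congr finterp.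
  by apply/funext => k; rewrite /comp s'K.
- by move=> r x; rewrite [X in _ <-> X]sr; have -> : s \o (s' \o x) = x
    by apply/funext => k; rewrite /comp s'K.
Qed.

Lemma aut_comp (s t : M -> M) :
  automorphism s -> automorphism t -> automorphism (t \o s).
Proof.
move=> [bs sf sr] [bt tf tr]; split; first exact: bij_comp.
- by move=> f x; rewrite /= sf tf.
- by move=> r x; rewrite sr tr.
Qed.

Lemma aut_id : automorphism (@id M).
Proof. by split=> //; exists id. Qed.

End FirstOrder.

(** * Small cardinals *)

Lemma card_le_injP (X Y : Type) :
  ([set: X] #<= [set: Y]) <-> exists f : X -> Y, injective f.
Proof.
split=> [/card_leP[f]|[f fi]]; last first.
  have /injfunPex[g] : exists2 f : X -> Y, set_fun [set: X] [set: Y] f &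
      set_inj [set: X] f by exists f => // x y _ _; exact: fi.
  exact: inj_card_le.
exists (fun x => val (f (SigSub (mem_set (I : [set: X] x))))) => x y.
move=> /val_inj fxy.
by have /(congr1 val) := inj (mem_set I) (mem_set I) fxy.
Qed.

Lemma card_le_total (X Y : Type) :
  [set: X] #<= [set: Y] \/ [set: Y] #<= [set: X].
Proof.
pose P (G : set (X * Y)) := forall u v, G u -> G v -> u.1 = v.1 <-> u.2 = v.2.
have [F FP Ftot|G [PG maxG]] := @Zorn_bigcup (X * Y) P.
  move=> u v [A FA Au] [B FB Bv].
  have [AB|BA] := Ftot _ _ FA FB.
    exact: (FP _ FB u v (AB _ Au) Bv).
  exact: (FP _ FA u v Au (BA _ Bv)).
have [/choice[f fG]|/existsNP[x xG]] :=
    pselect (forall x, exists y, G (x, y)).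
  left; apply/card_le_injP; exists f => x x' e.
  by apply/(PG (x, f x) (x', f x')).
have [/choice[f fG]|/existsNP[y yG]] :=
    pselect (forall y, exists x, G (x, y)).
  right; apply/card_le_injP; exists f => y y' e.
  by apply/(PG (f y, y) (f y', y')).
exfalso; apply: (maxG (G `|` [set (x, y)])).
  split=> [u Gu|]; first by left.
  by move=> /(_ (x, y)) H; apply: xG; exists y; apply: H; right.
move=> u v [Gu|->] [Gv|->] //=; first exact: PG.
- split=> e; case: u Gu e => u1 u2 /= Gu e; exfalso.
    by apply: xG; exists u2; rewrite -e.
  by apply: yG; exists u1; rewrite -e.
- split=> e; case: v Gv e => u1 u2 /= Gu e; exfalso.
    by apply: xG; exists u2; rewrite e.
  by apply: yG; exists u1; rewrite e.
Qed.

Section Small.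
Variable K : Type.

Lemma small_le (X Y : Type) (A : set X) (B : set Y) :
  A #<= B -> small K B -> small K A.
Proof.
move=> AB [BK KB]; split=> [|KA]; first exact: card_le_trans BK.
by apply: KB; exact: card_le_trans AB.
Qed.

Lemma small_inj (X Y : Type) (f : X -> Y) : injective f ->
  small K [set: Y] -> small K [set: X].
Proof. by move=> fi; apply: small_le; apply/card_le_injP; exists f. Qed.

Lemma small_range (X Y : Type) (f : X -> Y) :
  small K [set: X] -> small K (range f).
Proof. exact: small_le (card_image_le _ _). Qed.

Hypothesis Kstrong : strong_limit K.

Lemma small_powerset (X : Type) : small K [set: X] -> small K [set: set X].
Proof.
move=> sX; have [/card_le_injP[f fi] _] := sX.
apply: small_le (Kstrong (small_range f sX)).
have /injfunPex[g] : exists2 g : set X -> set K,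
    set_fun [set: set X] [set B | B `<=` range f] g & set_inj [set: set X] g.
  exists (fun B => f @` B) => [B _ _ [x _ <-]|B C _ _ BC]; first by exists x.
  apply/funext => x; apply/propext; split=> Bx.
    by have [y Cy /fi<-] : (f @` C) (f x) by rewrite -BC; exists x.
  by have [y Cy /fi<-] : (f @` B) (f x) by rewrite BC; exists x.
exact: inj_card_le.
Qed.

(** A strong limit is closed under power sets, and once the smaller factor embeds into the larger
    one, pairs live in an iterated power set of the latter. *)
Lemma small_prod (X Y : Type) :
  small K [set: X] -> small K [set: Y] -> small K [set: (X * Y)%type].
Proof.
have wlog_prod U V : [set: U] #<= [set: V] -> small K [set: V] ->
    small K [set: (U * V)%type].
  move=> /card_le_injP[f fi] sV.
  (* Kuratowski pairs *)
  apply: (@small_inj _ (set (set V))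
    (fun u => [set [set f u.1]; [set f u.1; u.2]])); last first.
    exact/small_powerset/small_powerset.
  move=> [u v] [u' v'] /= e.
  have euu' : u = u'.
    apply: fi.
    have : [set [set f u]; [set f u; v]] [set f u] by left.
    rewrite e => -[] e'; have : [set f u] (f u) by [].
      by rewrite e'.
    by have : [set f u] (f u') by rewrite e'; left.
  rewrite -euu' in e *; congr pair.
  have : [set [set f u]; [set f u; v']] [set f u; v] by rewrite -e; right.
  move=> [] e1; last first.
    have : [set f u; v] v by right.
    rewrite e1 => -[] // vu; have : [set f u; v'] v' by right.
    by rewrite -e1 => -[->|->].
  have : [set f u; v] v by right.
  rewrite e1 => vu.
  have : [set [set f u]; [set f u; v]] [set f u; v'] by rewrite e; right.
  move=> [] e2; have : [set f u; v'] v' by right.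
    by rewrite e2 => ->.
  by rewrite e2 e1 => ->.
move=> sX sY; have [XY|YX] := card_le_total X Y; first exact: wlog_prod.
apply: (@small_inj _ _ (fun u : X * Y => (u.2, u.1))) (wlog_prod _ _ YX sX).
by move=> [x y] [x' y'] [-> ->].
Qed.

End Small.

(** * Saturation and homogeneity *)

Lemma finite_set_seq (X : Type) (A : set X) : finite_set A ->
  exists s : seq X, forall x, A x -> List.In x s.
Proof.
move=> /(@finite_seqP {classic X})[s ->]; exists s => x /=.
by elim: s => //= y s IH; rewrite inE => /orP[/eqP->|/IH]; [left|right].
Qed.

Section Monster.
Variables (L : language) (T : theory L) (K : Type) (M : structure L).
Hypothesis Mmonster : monster T K M.

Lemma monster_small_prod (X Y : Type) :
  small K [set: X] -> small K [set: Y] -> small K [set: (X * Y)%type].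
Proof. by case: Mmonster => SK _ _ _ _; exact: small_prod. Qed.

Lemma small_nat : small K [set: nat].
Proof.
have [_ sF _ _ _] := Mmonster.
by apply: (@small_inj _ _ _ (fun n => Eqn (Var L n) (Var L n))) sF => m n [].
Qed.

Lemma small_sum (X Y : Type) :
  small K [set: X] -> small K [set: Y] -> small K [set: (X + Y)%type].
Proof.
move=> sX sY.
have wlog_sum U V : [set: U] #<= [set: V] -> small K [set: V] ->
    small K [set: (U + V)%type].
  move=> /card_le_injP[f fi] sV.
  apply: (@small_inj _ _ _ (fun u : U + V => match u with inl x => (0, f x)
    | inr y => (1, y) end)) (monster_small_prod small_nat sV).
  by move=> [x|x] [y|y] [] // => [/fi|] ->.
have [XY|YX] := card_le_total X Y; first exact: wlog_sum.
apply: (@small_inj _ _ _ (fun u : X + Y => match u with inl x => inr x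
  | inr y => inl y end)) (wlog_sum _ _ YX sX).
by move=> [x|x] [y|y] // [->].
Qed.

Lemma small_option (X : Type) : small K [set: X] -> small K [set: option X].
Proof.
move=> sX; apply: (@small_inj _ _ _ (fun u =>
  if u is Some x then inl x else inr 0))
  (small_sum sX small_nat).
by move=> [x|] [y|] // [->].
Qed.

(* A maximal partial assignment all of whose finite requirements remain
   satisfiable is total, by saturation in one variable. *)
Lemma realize (W V : Type) (e0 : W -> M) (Gam : set (formula L (W + V))) :
  small K [set: W] -> small K [set: V] ->
  (forall s : seq (formula L (W + V)), (forall p, List.In p s -> Gam p) ->
     exists f, forall p, List.In p s -> sat p (pair_env e0 f)) ->
  exists f, forall p, Gam p -> sat p (pair_env e0 f).
Proof.
move=> sW sV Gfin.
pose sub (s : seq (formula L (W + V))) := forall p, List.In p s -> Gam p.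
pose ext (G : set (V * M)) (f : V -> M) := forall v x, G (v, x) -> f v = x.
pose P G := forall s, sub s -> exists f, ext G f /\
  forall p, List.In p s -> sat p (pair_env e0 f).
have Pfun G v x y : P G -> G (v, x) -> G (v, y) -> x = y.
  by move=> /(_ [::])[//|f [ef _]] /ef<- /ef.
have [F FP Ftot|G [PG maxG]] := @Zorn_bigcup (V * M) P.
  have [[G0 FG0]|F0] := pselect (exists G, F G); last first.
    move=> s /Gfin[f Hf]; exists f; split=> // v x [G FG].
    by case: F0; exists G.
  pose U := \bigcup_(X in F) X.
  have Ufun v x y : U (v, x) -> U (v, y) -> x = y.
    move=> [A FA Ax] [B FB By]; have [AB|BA] := Ftot _ _ FA FB.
      by apply: (Pfun B v) => //; [exact: FP|exact: AB].
    by apply: (Pfun A v) => //; [exact: FP|exact: BA].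
  (* Finitely many requirements depend on finitely many variables, and one member of the chain
     already assigns all of these that the union assigns. *)
  have cover (S : seq V) : exists2 G, F G &
      forall v, List.In v S -> forall x, U (v, x) -> G (v, x).
    elim: S => [|v S [G1 FG1 HG1]]; first by exists G0.
    have [[x [G2 FG2 G2x]]|nU] := pselect (exists x, U (v, x)); last first.
      exists G1 => // w [<-|] x Ux; last exact: HG1.
      by case: nU; exists x.
    have [G12|G21] := Ftot _ _ FG1 FG2.
      exists G2 => // w [<-|wS] y Uy; last by apply: G12; apply: HG1.
      by rewrite -(@Ufun v x y) //; exists G2.
    exists G1 => // w [<-|] y Uy; last exact: HG1.
    by rewrite -(@Ufun v x y) //; [exact: G21|exists G2].
  move=> s ss.
  have [p0 Hp0] := definable_all s (@definable_sat L M (W + V)).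
  have [S HS] := sat_support M p0.
  pose S' := pmap (fun u : W + V => if u is inr v then Some v else None) S.
  have Sin v : List.In (inr v) S -> List.In v S'.
    by move=> vS; exact: In_pmap vS erefl.
  have [G FG HG] := cover S'.
  have [f [ef Hf]] := FP _ FG _ ss.
  have /choice[f' Hf'] : forall v, exists x, U (v, x) \/
      ((forall y, ~ U (v, y)) /\ x = f v).
    move=> v; have [[x Ux]|nU] := pselect (exists x, U (v, x)).
      by exists x; left.
    by exists (f v); right; split=> // y Uy; apply: nU; exists y.
  exists f'; split=> [v x Ux|].
    by have [Ux'|[/(_ x)//]] := Hf' v; exact: Ufun Ux' Ux.
  apply/Hp0; apply/(HS _ (pair_env e0 f)); last exact/Hp0.
  move=> [w|v] //= vS; have [Ux|[_ //]] := Hf' v.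
  by apply/esym/ef/HG => //; exact: Sin.
suff /choice[f Hf] : forall v, exists x, G (v, x).
  exists f => p Gp; have [|f' [ef' /(_ p)]] := PG [:: p].
    by move=> q [<-|].
  suff -> : f' = f by apply; left.
  by apply/funext => v; exact: ef'.
apply: contrapT => /existsNP[v0 Gv0].
have [|f0 [ef0 _]] := PG [::]; first by [].
(* Some [f0] extending [G] supplies the parameters. Its values off the domain of [G] are arbitrary:
   they are quantified away through [Q], except at [v0], which becomes the free variable [None]. *)
pose h := pair_env e0 f0; pose A := range h.
have sA : small K A by exact/small_range/small_sum.
have [_ _ _ satM _] := Mmonster.
pose par u : A := SigSub (mem_set (imageT h u)).
pose rho (u : W + V) : option A :=
  if u is inr v then if pselect (v = v0) then None else Some (par u)
  else Some (par u).
pose Q (u : W + V) := if u is inr v then v <> v0 /\ ~ (exists x, G (v, x))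
  else False.
pose D s (e : W + V -> M) := exists f : W + V -> M,
  (forall u, ~ Q u -> f u = e u) /\ forall p, List.In p s -> sat p f.
have dD s : definable (D s).
  exact/definable_exP/definable_all/definable_sat.
pose typ (q : formula L (option A)) := exists s, sub s /\
  exists2 p, forall e, D s e <-> sat p e & q = rename rho p.
have fsat q : q `<=` typ -> finite_set q ->
    exists x : M, forall f, q f -> sat f (extend val x).
  move=> qtyp /finite_set_seq[lq Hlq].
  have [s [ss Hs]] : exists s, sub s /\ forall f, List.In f lq -> q f ->
      exists s', [/\ sub s', forall p, List.In p s' -> List.In p s &
      exists2 p, forall e, D s' e <-> sat p e & f = rename rho p].
    elim: (lq) => [|f l [s [ss Hs]]]; first by exists [::]; split=> // p [].
    have [qf|nqf] := pselect (q f); last first.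
      by exists s; split=> // g [<-//|]; exact: Hs.
    have [s' [ss' Hs']] := qtyp _ qf.
    exists (s' ++ s); split=> [p /List.in_app_iff[|]|g [<- _|gl qg]].
    - exact: ss'.
    - exact: ss.
    - by exists s'; split=> // p ps; apply/List.in_app_iff; left.
    - have [s'' [H1 H2 H3]] := Hs _ gl qg; exists s''; split=> // p /H2 ps.
      by apply/List.in_app_iff; right.
  have [f [ef Hf]] := PG _ ss; exists (f v0) => g qg.
  have [s' [ss' sub' [p Hp ->]]] := Hs g (Hlq _ qg) qg.
  apply/sat_rename/Hp; exists (pair_env e0 f); split=> [|r rs]; last first.
    exact/Hf/sub'.
  move=> [w|v] nQ //=; case: pselect => /= [->//|vv0].
  have [[x Gx]|nx] := pselect (exists x, G (v, x)); last by case: nQ.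
  by rewrite (ef _ _ Gx) (ef0 _ _ Gx).
have [x Hx] := satM A sA typ fsat.
apply: (maxG (G `|` [set (v0, x)])).
  split=> [u Gu|/(_ (v0, x)) H]; first by left.
  by apply: Gv0; exists x; apply: H; right.
move=> s ss; have [p Hp] := dD s.
have /Hx/sat_rename/Hp[f [fe Hf]] : typ (rename rho p).
  by exists s; split=> //; exists p.
have ef : pair_env e0 (f \o inr) = f.
  by apply/funext => -[w|v] //=; rewrite fe.
exists (f \o inr); rewrite ef; split=> // v y [Gy|[-> ->]] /=; last first.
  by rewrite fe /=; [case: pselect|case].
rewrite fe /=; last by case=> _; apply; exists y.
case: pselect => /= [v0E|vv0]; last exact: ef0.
by case: Gv0; exists y; rewrite -v0E.
Qed.

Lemma homogeneous (V : Type) (a b : V -> M) : small K [set: V] ->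
  same_type a b -> exists2 s, automorphism s & s \o a = b.
Proof.
move=> sV ab; have [_ _ _ _ hom] := Mmonster.
have /choice[g Hg] : forall x : range a, exists v, a v = val x.
  by move=> x; have [v _ va] := set_mem (valP x); exists v.
(* Equalities between entries belong to the type, so sending [a] to [b] is a well-defined map on the
   range of [a]. *)
have abE u v : a u = a v -> b u = b v.
  by move=> H; have /= [-> //] := ab (Eqn (Var L u) (Var L v)).
have [|s aut_s sE] := hom _ (small_range a sV) (b \o g).
  move=> p; have ag : a \o g = val by apply/funext => x; exact: Hg.
  have := ab (rename g p); rewrite (sat_rename _ _ a) (sat_rename _ _ b).
  by rewrite ag.
exists s => //; apply/funext => v /=.
pose x : range a := SigSub (mem_set (imageT a v)).
by have := sE x; rewrite /= => ->; apply: abE; rewrite Hg.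
Qed.

End Monster.

(** * Type-definable sets and the independence property *)

Lemma mem_bound (s : seq nat) : exists N, forall k, List.In k s -> k < N.
Proof.
elim: s => [|k s [N HN]]; first by exists 0 => k [].
exists (maxn k.+1 N) => j [->|/HN]; first exact: leq_maxl.
by move/leq_trans; apply; exact: leq_maxr.
Qed.

Section Compactness.
Variables (L : language) (T : theory L) (K : Type) (M : structure L).
Hypothesis Mmonster : monster T K M.

Lemma realize_definable (W V J : Type) (D : J -> (W + V -> M) -> Prop)
    (e0 : W -> M) :
  small K [set: W] -> small K [set: V] -> (forall j, definable (D j)) ->
  (forall s : seq J, exists f, forall j, List.In j s -> D j (pair_env e0 f)) ->
  exists f, forall j, D j (pair_env e0 f).
Proof.
move=> sW sV /choice[p Hp] Dfin.
have [|f Hf] := realize Mmonster (e0 := e0) (Gam := range p) sW sV.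
  move=> s ss.
  have [js Hjs] : exists js, forall q, List.In q s ->
    exists2 j, List.In j js & p j = q.
    elim: s ss => [_|q s IH ss]; first by exists [::].
    have [|js Hjs] := IH; first by move=> r rs; apply: ss; right.
    have [j _ <-] := ss q (or_introl erefl); exists (j :: js) => r [<-|/Hjs].
      by exists j => //; left.
    by move=> [i ijs <-]; exists i => //; right.
  by have [f Hf] := Dfin js; exists f => q /Hjs[j /Hf Dj <-]; apply/Hp.
by exists f => j; apply/Hp/Hf; exists j.
Qed.

Lemma finite_code (U : Type) (s : seq U) : exists m (c : U -> 'I_m)
  (t : (U -> M) -> 'I_m -> M), forall a u, List.In u s -> t a (c u) = a u.
Proof.
have [x0] := dom_inhabited M.
pose s' : seq {classic U} := s.
(* The successor leaves an index for the elements outside [s] and keeps the index type inhabited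
   when [s] is empty. *)
exists (size s).+1, (fun u => inord (index (u : {classic U}) s')),
  (fun a k => nth x0 (map a s') k) => a u us.
have us' : (u : {classic U}) \in s'.
  rewrite /s'; elim: (s) us => //= v l IH [->|/IH]; rewrite inE ?eqxx //.
  by move=> ->; rewrite orbT.
rewrite inordK ?ltnS ?index_size // (nth_map (u : {classic U})) ?index_mem //.
by rewrite nth_index.
Qed.

(** The independence property is defined with finite tuples of variables, whereas formulas here have
    arbitrary types of variables; [t] and [t'] translate the tuples. *)
Lemma finite_variables (U V : Type) (p : formula L (U + V)) : exists m n
  (q : formula L ('I_m + 'I_n)) (t : (U -> M) -> 'I_m -> M)
  (t' : (V -> M) -> 'I_n -> M),
  forall a b, sat q (pair_env (t a) (t' b)) <-> sat p (pair_env a b).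
Proof.
have [s Hs] := sat_support M p.
have [m [c [t Ht]]] :=
  finite_code (pmap (fun w : U + V => if w is inl u then Some u else None) s).
have [n [c' [t' Ht']]] :=
  finite_code (pmap (fun w : U + V => if w is inr u then Some u else None) s).
pose r (w : U + V) := match w with inl u => inl (c u) | inr v => inr (c' v) end.
exists m, n, (rename r p), t, t' => a b; rewrite sat_rename.
by apply: Hs => -[u|v] us /=; [apply: Ht|apply: Ht']; exact: In_pmap us erefl.
Qed.

(* The sequence is found first, such that all finite patterns are cut out;
   each infinite pattern is then realized on its own. *)
Lemma shatter_has_IP (U V : Type) (p : formula L (U + V)) :
  (forall N, exists (u : nat -> U -> M) (v : (nat -> bool) -> V -> M),
     forall S n, n < N -> sat p (pair_env (u n) (v S)) <-> S n) ->
  exists m n (q : formula L ('I_m + 'I_n)), has_IP M q.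
Proof.
move=> Hp; have [m [n [q [t [t' Hq]]]]] := finite_variables p.
exists m, n, q.
have sI k : small K [set: 'I_k].
  by apply: (@small_inj _ _ _ (@nat_of_ord k)) (small_nat Mmonster); exact:
    ord_inj.
have sV : small K [set: void].
  by apply: (@small_inj _ _ _ (of_void nat)) (small_nat Mmonster) => -[].
have sNI := monster_small_prod Mmonster (small_nat Mmonster) (sI m).
pose D (NS : nat * (nat -> bool)) (e : void + nat * 'I_m -> M) :=
  exists b : 'I_n -> M, forall k, List.In k (iota 0 NS.1) ->
    sat q (pair_env (fun i => e (inr (k, i))) b) <-> NS.2 k.
have iotaP k N : List.In k (iota 0 N) <-> k < N.
  rewrite -[k < N]/(0 <= k < 0 + N) -mem_iota; elim: (iota 0 N) => //= j l ->.
  rewrite inE; split=> [[->|->]|/orP[/eqP->|]]; rewrite ?eqxx ?orbT //;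
    last by right.
  by left.
have [||a Ha] := @realize_definable _ _ _ D (of_void M) sV sNI.
- move=> [N S]; pose r k (w : 'I_m + 'I_n) : (void + nat * 'I_m) + 'I_n :=
    match w with inl i => inl (inr (k, i)) | inr j => inr j end.
  have dk k : definable (fun e : _ -> M => sat q (e \o r k) <-> S k).
    have d := definable_rename (r k) (definable_sat M q); case: (S k).
      by apply: definable_ext d => e; split=> [[_ H]|H]; [exact: H|split].
    apply: definable_ext (definable_not d) => e.
    by split=> [[H _] /H|H] //; split=> [/H|].
  have := definable_proj (definable_all (iota 0 N) dk).
  apply: definable_ext => e; split=> -[b Hb]; exists b => k kN; have := Hb k kN;
  rewrite (_ : pair_env e b \o r k = pair_env (fun i => e (inr (k, i))) b) //;
  by apply/funext => -[].
- move=> s; have [N HN] := mem_bound (map fst s).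
  have [u [v Huv]] := Hp N; exists (fun w => t (u w.1) w.2) => -[N' S] sNS.
  exists (t' (v S)) => k /iotaP kN'; rewrite -Huv; last first.
    by apply: ltn_trans kN' _; apply: HN; apply/List.in_map_iff; exists (N', S).
  by rewrite -Hq.
have Hb (S : set nat) : exists b : 'I_n -> M,
    forall k, sat q (pair_env (fun i => a (k, i)) b) <-> S k.
  pose D' k (e : nat * 'I_m + 'I_n -> M) :=
    sat q (pair_env (fun i => e (inl (k, i))) (e \o inr)) <-> S k.
  have [||b Hb] := @realize_definable _ _ _ D' a sNI (sI n).
  - move=> k; pose r (w : 'I_m + 'I_n) : nat * 'I_m + 'I_n :=
      match w with inl i => inl (k, i) | inr j => inr j end.
    have d := definable_rename r (definable_sat M q).
    have rE (e : _ -> M) : e \o r = pair_env (fun i =>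
      e (inl (k, i))) (e \o inr).
      by apply/funext => -[].
    have [Sk|nSk] := pselect (S k).
      apply: definable_ext d => e; rewrite rE /D'.
      by split=> [[_ H]|H]; [exact: H|split].
    apply: definable_ext (definable_not d) => e; rewrite rE /D'.
    by split=> [[H _] /H|H] //; split=> [/H|].
  - move=> s; have [N HN] := mem_bound s.
    have [b Hb] := Ha (N, fun k => `[< S k >]); exists b => k ks.
    by rewrite /D' /= Hb; [split=> /asboolP|apply/iotaP; exact: HN].
  by exists b.
have [b Hb'] := choice Hb.
by exists (fun k i => a (k, i)), b => k S; exact: Hb'.
Qed.

(** * Type-definable conditions on families of tuples *)

Variable Lam : Type.
Hypothesis sLam : small K [set: Lam].
Local Notation A := (Lam -> M).

(** In the space of types in the variables [X * Lam], [tdefinable] conditions are the clopen sets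
    and [tclosed] conditions the closed ones. *)
Definition tdefinable (X : Type) (D : (X -> A) -> Prop) :=
  definable (fun e : X * Lam -> M => D (fun x l => e (x, l))).

Definition tclosed (X : Type) (C : (X -> A) -> Prop) :=
  exists F : set (formula L (X * Lam)), forall e,
    C (fun x l => e (x, l)) <-> forall p, F p -> sat p e.

Lemma tclosed_tdefinable (X : Type) (D : (X -> A) -> Prop) :
  tdefinable D -> tclosed D.
Proof.
by move=> [p Hp]; exists [set p] => e; rewrite Hp; split=> [H q ->|];
  last exact.
Qed.

Lemma tclosed_forall (X J : Type) (C : J -> (X -> A) -> Prop) :
  (forall j, tclosed (C j)) -> tclosed (fun e => forall j, C j e).
Proof.
move=> /choice[F HF]; exists (fun p => exists j, F j p) => e; split.
  by move=> Ce p [j]; apply: (HF j e).1.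
by move=> He j; apply/HF => p Fp; apply: He; exists j.
Qed.

Lemma tclosed_and (X : Type) (C D : (X -> A) -> Prop) :
  tclosed C -> tclosed D -> tclosed (fun e => C e /\ D e).
Proof.
move=> [F HF] [G HG]; exists (F `|` G) => e; rewrite HF HG; split.
  by move=> [Hf Hg] p [/Hf|/Hg].
by move=> H; split=> p ?; apply: H; [left|right].
Qed.

Lemma tclosed_reindex (X Y : Type) (r : Y -> X) (C : (Y -> A) -> Prop) :
  tclosed C -> tclosed (fun e => C (e \o r)).
Proof.
move=> [F HF]; pose r' (v : Y * Lam) := (r v.1, v.2).
exists (rename r' @` F) => e.
have := HF (e \o r'); rewrite /comp /= => ->.
split=> [H _ [p Fp <-]|H p Fp]; last by apply/sat_rename/H; exists p.
exact/sat_rename/H.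
Qed.

Lemma tdefinable_reindex (X Y : Type) (r : Y -> X) (D : (Y -> A) -> Prop) :
  tdefinable D -> tdefinable (fun e => D (e \o r)).
Proof. by move=> /(definable_rename (fun v : Y * Lam => (r v.1, v.2))). Qed.

Definition distr (X Y : Type) (v : (X + Y) * Lam) : X * Lam + Y * Lam :=
  match v.1 with inl x => inl (x, v.2) | inr y => inr (y, v.2) end.

Lemma distr_env (X Y : Type) (e : X * Lam + Y * Lam -> M) :
  (fun x l => e (distr (x, l))) =
  pair_env (fun x l => e (inl (x, l))) (fun y l => e (inr (y, l))).
Proof. by apply/funext => -[]. Qed.

Lemma tdefinable_proj (X Y : Type) (D : (X + Y -> A) -> Prop) :
  tdefinable D -> tdefinable (fun e => exists f, D (pair_env e f)).
Proof.
move=> /(definable_rename (@distr X Y))/definable_proj; apply: definable_ext.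
move=> e; split=> [[f Df]|[f]].
  by exists (fun v => f v.1 v.2); rewrite /comp /= distr_env.
by rewrite /comp /= distr_env => Df; exists (fun y l => f (y, l)).
Qed.

Lemma tcompact (X Y J : Type) (C : J -> (X + Y -> A) -> Prop) (e0 : X -> A) :
  small K [set: X] -> small K [set: Y] -> (forall j, tclosed (C j)) ->
  (forall s : seq J, exists f, forall j, List.In j s -> C j (pair_env e0 f)) ->
  exists f, forall j, C j (pair_env e0 f).
Proof.
move=> sX sY /choice[F HF] Cfin.
have FE j e f : C j (pair_env e f) <-> forall p, F j p ->
    sat p (pair_env (fun v => e v.1 v.2) (fun v => f v.1 v.2) \o @distr X Y).
  by rewrite -HF /comp distr_env.
pose D (jp : {jp : J * formula L ((X + Y) * Lam) | F jp.1 jp.2})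
    (e : X * Lam + Y * Lam -> M) :=
  sat (sval jp).2 (e \o @distr X Y).
have [||f Hf] := @realize_definable _ _ _ D (fun v => e0 v.1 v.2)
    (monster_small_prod Mmonster sX sLam) (monster_small_prod Mmonster sY sLam).
- by move=> j; apply: definable_rename; exact: definable_sat.
- move=> s; have [f Hf] := Cfin (map (fun x => (sval x).1) s).
  exists (fun v => f v.1 v.2) => -[[j p] /= Fp] jps; apply: (FE j e0 f).1 => //.
  by apply: Hf; apply/List.in_map_iff; exists (exist _ (j, p) Fp).
exists (fun y l => f (y, l)) => j; apply/FE => p Fp.
have := Hf (exist _ (j, p) Fp); rewrite /D /=.
by rewrite (_ : (fun v => f (v.1, v.2)) = f) //; apply/funext => -[].
Qed.

Lemma tcompact0 (Y J : Type) (C : J -> (Y -> A) -> Prop) :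
  small K [set: Y] -> (forall j, tclosed (C j)) ->
  (forall s : seq J, exists f, forall j, List.In j s -> C j f) ->
  exists f, forall j, C j f.
Proof.
move=> sY cC Cfin.
have sV : small K [set: void].
  by apply: (@small_inj _ _ _ (of_void nat)) (small_nat Mmonster) => -[].
have [||f] := @tcompact void Y J (fun j e => C j (e \o inr)) (of_void A) sV sY.
- by move=> j; exact: tclosed_reindex.
- by move=> s; have [f] := Cfin s; exists f.
by exists f.
Qed.

(** The projection is cut out by all formulas that hold on it: the projection of each finite part of
    [F] is one of them, and saturation then supplies a common witness. *)
Lemma tclosed_proj (X Y : Type) (C : (X + Y -> A) -> Prop) :
  small K [set: X] -> small K [set: Y] -> tclosed C ->
  tclosed (fun e => exists f, C (pair_env e f)).
Proof.
move=> sX sY [F HF].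
exists (fun q => forall e f, C (pair_env e f) -> sat q (fun v => e v.1 v.2)) =>
  e.
split=> [[f Cf] q /(_ _ _ Cf)|He].
  by rewrite (_ : (fun v => e (v.1, v.2)) = e) //; apply/funext => -[].
pose D (p : {p | F p}) (e : X + Y -> A) := sat (sval p) (fun v => e v.1 v.2).
have dD p : tdefinable (D p).
  apply: definable_ext (definable_sat M (sval p)) => g; rewrite /D.
  by rewrite (_ : (fun v => g (v.1, v.2)) = g) //; apply/funext => -[].
have [||f Hf] := @tcompact X Y _ D (fun x l => e (x, l)) sX sY.
- by move=> p; exact: tclosed_tdefinable.
- move=> s; have dDs : tdefinable (fun e => forall p, List.In p s -> D p e).
    exact: definable_all.
  have [q Hq] := tdefinable_proj dDs; apply/Hq; apply: He => g f Cgf.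
  apply/Hq; exists f => -[p Fp] _; rewrite /D /=.
  by have := (HF (fun v => pair_env g f v.1 v.2)).1; apply.
exists f; have /HF : forall p, F p -> sat p (fun v => pair_env (fun x l =>
  e (x, l)) f v.1 v.2).
  by move=> p Fp; exact: (Hf (exist _ p Fp)).
by [].
Qed.

(** If every finite part of the formulas defining [D] were consistent with [C], compactness would
    give a common solution. This replaces a type-definable [D] by a formula, to which NIP
    applies. *)
Lemma tseparate (X Y : Type) (r : Y -> X) (C : (X -> A) -> Prop)
    (D : (Y -> A) -> Prop) :
  small K [set: X] -> tclosed C -> tclosed D ->
  (forall e, C e -> ~ D (e \o r)) ->
  exists2 G, tdefinable G &
    (forall e, D e -> G e) /\ (forall e, C e -> ~ G (e \o r)).
Proof.
move=> sX cC [F HF] CD.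
pose G (p : {p | F p}) (e : Y -> A) := sat (sval p) (fun v => e v.1 v.2).
have dG p : tdefinable (G p).
  apply: definable_ext (definable_sat M (sval p)) => g; rewrite /G.
  by rewrite (_ : (fun v => g (v.1, v.2)) = g) //; apply/funext => -[].
apply: contrapT => nsep.
have [||e He] := @tcompact0 X {p | F p} (fun p e => C e /\ G p (e \o r)) sX.
- move=> p; apply: tclosed_and => //; apply: tclosed_reindex.
  exact: tclosed_tdefinable.
- move=> s; apply: contrapT => /forallNP nf; apply: nsep.
  exists (fun e => forall p, List.In p s -> G p e); first exact: definable_all.
  split=> [e De [p Fp] _|e Ce Ge].
    by rewrite /G /=; have := (HF (fun v => e v.1 v.2)).1; apply.
  by apply: (nf e) => p ps; split=> //; exact: Ge.
(* With [F] empty, [He] is an empty family and does not yield [C e]; but then [D] always holds, so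
   [C] never does. *)
have [[p Fp]|nF] := pselect (exists p, F p).
  have [Ce _] := He (exist _ p Fp); apply: (CD e Ce).
  have := HF (fun v => e (r v.1) v.2) => /=; rewrite /comp => -[_]; apply.
  by move=> q Fq; exact: (He (exist _ q Fq)).2.
apply: nsep; exists (fun _ => True); first exact: definable_true.
split=> // e' Ce'; exfalso; apply: (CD e' Ce').
have := HF (fun v => e' (r v.1) v.2) => /=; rewrite /comp => -[_]; apply.
by move=> q Fq; case: nF; exists q.
Qed.

Lemma NIP_no_shatter (X Y : Type) (D : (X + Y -> A) -> Prop) : NIP T ->
  tdefinable D ->
  ~ forall N, exists (u : nat -> X -> A) (v : (nat -> bool) -> Y -> A),
      forall S n, n < N -> D (pair_env (u n) (v S)) <-> S n.
Proof.
move=> nip /(definable_rename (@distr X Y))[p Hp] HD.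
have [_ _ MT _ _] := Mmonster.
have [|m [n [q Hq]]] := @shatter_has_IP _ _ p; last exact: (nip M MT m n q).
move=> N; have [u [v Huv]] := HD N.
exists (fun k w => u k w.1 w.2), (fun S w => v S w.1 w.2) => S k kN.
by rewrite -Hp /comp distr_env; exact: Huv.
Qed.

End Compactness.

(** * Conjugate lists of tuples *)

(** A mask asks for no decidable equality on the entries, and it commutes with [map], [act] and both
    notions of conjugacy. *)
Definition sublist (X : Type) (s t : seq X) :=
  exists2 m : bitseq, size m = size t & s = mask m t.

Lemma sublist_refl (X : Type) (s : seq X) : sublist s s.
Proof. by exists (nseq (size s) true); rewrite ?size_nseq ?mask_true. Qed.

Lemma sublist_nil (X : Type) (s : seq X) : sublist [::] s.
Proof. by exists (nseq (size s) false); rewrite ?size_nseq ?mask_false. Qed.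

Lemma sublist_cat (X : Type) (s1 s2 t1 t2 : seq X) :
  sublist s1 t1 -> sublist s2 t2 -> sublist (s1 ++ s2) (t1 ++ t2).
Proof.
move=> [m1 z1 ->] [m2 z2 ->]; exists (m1 ++ m2); last by rewrite mask_cat.
by rewrite !size_cat z1 z2.
Qed.

Lemma sublist_cons (X : Type) x (s t : seq X) :
  sublist s t -> sublist (x :: s) (x :: t).
Proof. exact: (sublist_cat (sublist_refl [:: x])). Qed.

Lemma sublist_skip (X : Type) (s t1 t2 : seq X) :
  sublist s t2 -> sublist s (t1 ++ t2).
Proof. exact: (sublist_cat (sublist_nil t1)). Qed.

Lemma sublist_skipr (X : Type) (s t1 t2 : seq X) :
  sublist s t1 -> sublist s (t1 ++ t2).
Proof. by move=> H; rewrite -[s]cats0; exact: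
  sublist_cat H (sublist_nil _). Qed.

Lemma sublist_skip1 (X : Type) x (s t : seq X) :
  sublist s t -> sublist s (x :: t).
Proof. exact: (@sublist_skip _ _ [:: x]). Qed.

Lemma sublist_trans (X : Type) (t s u : seq X) :
  sublist s t -> sublist t u -> sublist s u.
Proof.
move=> st [m _ tE]; move: st; rewrite {}tE.
elim: u s m => [|x u IH] s [|b m] /=; try by move=> [[|//] _ ->]; exact:
  sublist_nil.
case: b => [[[//|c m'] [zm] ->]|/IH]; last exact: sublist_skip1.
have /IH H : sublist (mask m' (mask m u)) (mask m u) by exists m'.
by case: c; [exact: sublist_cons|exact: sublist_skip1].
Qed.

Lemma sublist_map (X Y : Type) (f : X -> Y) (s t : seq X) :
  sublist s t -> sublist (map f s) (map f t).
Proof. by move=> [m z ->]; exists m; rewrite ?size_map ?map_mask. Qed.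

Section Forall2.
Variables (X Y : Type) (r : X -> Y -> Prop).

Lemma Forall2_size s t : List.Forall2 r s t -> size s = size t.
Proof. by elim=> //= ? ? ? ? _ _ ->. Qed.

Lemma Forall2_cat s1 s2 t1 t2 : List.Forall2 r s1 t1 -> List.Forall2 r s2 t2 ->
  List.Forall2 r (s1 ++ s2) (t1 ++ t2).
Proof. by move=> H1 H2; elim: H1 => //= *; constructor. Qed.

Lemma Forall2_consl x s t : List.Forall2 r (x :: s) t ->
  exists y t', [/\ t = y :: t', r x y & List.Forall2 r s t'].
Proof. by move=> H; inversion H; subst; eexists _, _. Qed.

Lemma Forall2_catl s1 s2 t : List.Forall2 r (s1 ++ s2) t ->
  exists t1 t2, [/\ t = t1 ++ t2, List.Forall2 r s1 t1 & List.Forall2 r s2 t2].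
Proof.
elim: s1 t => [|x s1 IH] t /= H; first by exists [::], t.
have [y [t' [-> rxy /IH[t1 [t2 [-> H1 H2]]]]]] := Forall2_consl H.
by exists (y :: t1), t2; split=> //; constructor.
Qed.

Lemma Forall2_mask m s t : List.Forall2 r s t ->
  List.Forall2 r (mask m s) (mask m t).
Proof.
move=> H; elim: H m => [|x y s' t' rxy _ IH] [|[] m] //=; by constructor.
Qed.

Lemma Forall2_map (Z : Type) (f : Z -> X) (g : Z -> Y) s :
  (forall z, List.In z s -> r (f z) (g z)) ->
  List.Forall2 r (map f s) (map g s).
Proof.
elim: s => [|z s IH] H /=; first by constructor.
by constructor; [apply: H; left|apply: IH => w ws; apply: H; right].
Qed.

Lemma Forall2_nth x0 y0 s t k : List.Forall2 r s t -> k < size s ->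
  r (nth x0 s k) (nth y0 t k).
Proof. by move=> H; elim: H k => //= x y s' t' rxy _ IH [|k] //=; exact:
  IH. Qed.

End Forall2.

Section Conjugacy.
Variables (L : language) (T : theory L) (K : Type) (M : structure L).
Hypothesis Mmonster : monster T K M.
Variable Lam : Type.
Hypothesis sLam : small K [set: Lam].
Local Notation A := (Lam -> M).

Definition act (s : M -> M) (y : seq A) : seq A := [seq s \o b | b <- y].

Definition conj (y y' : seq A) := exists2 s, automorphism s & y' = act s y.

Lemma act_comp s t y : act t (act s y) = act (t \o s) y.
Proof. by rewrite /act -map_comp. Qed.

Lemma conj_refl y : conj y y.
Proof. by exists id; [exact: aut_id|rewrite /act map_id]. Qed.

Lemma conj_sym y y' : conj y y' -> conj y' y.
Proof.
move=> [s aut_s ->]; have [s' [aut_s' sK _]] := aut_inv aut_s.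
exists s' => //; rewrite act_comp /act -[LHS]map_id; apply: eq_map => b.
by apply/funext => l /=; rewrite sK.
Qed.

Lemma conj_trans y y' y'' : conj y y' -> conj y' y'' -> conj y y''.
Proof.
move=> [s aut_s ->] [t aut_t ->]; exists (t \o s); last by rewrite act_comp.
exact: aut_comp.
Qed.

Lemma conj_size y y' : conj y y' -> size y = size y'.
Proof. by move=> [s _ ->]; rewrite size_map. Qed.

Lemma act_mask s m y : act s (mask m y) = mask m (act s y).
Proof. by rewrite /act map_mask. Qed.

Lemma act_cat s y z : act s (y ++ z) = act s y ++ act s z.
Proof. exact: map_cat. Qed.

Lemma conj_mask m y y' : conj y y' -> conj (mask m y) (mask m y').
Proof. by move=> [s aut_s ->]; exists s; rewrite ?act_mask. Qed.

Lemma small_ord_prod n : small K [set: ('I_n * Lam)%type].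
Proof.
apply: (monster_small_prod Mmonster) => //.
by apply: (@small_inj _ _ _ (@nat_of_ord n)) (small_nat Mmonster); exact:
  ord_inj.
Qed.

Lemma same_typeP n (f g : 'I_n -> A) :
  same_type (fun v : 'I_n * Lam => f v.1 v.2) (fun v => g v.1 v.2) <->
  exists2 s, automorphism s & forall k, s \o f k = g k.
Proof.
split=> [/(homogeneous Mmonster (@small_ord_prod n))[s aut_s H]|[s aut_s H] p].
  by exists s => // k; apply/funext => l; exact: (congr1 (@^~ (k, l)) H).
rewrite -(sat_aut aut_s).
rewrite (_ : s \o _ = fun v => g v.1 v.2) //.
by apply/funext => -[k l]; rewrite /= -H.
Qed.

Lemma conj_mapP n (f g : 'I_n -> A) :
  conj (map f (enum 'I_n)) (map g (enum 'I_n)) <->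
  same_type (fun v : 'I_n * Lam => f v.1 v.2) (fun v => g v.1 v.2).
Proof.
rewrite same_typeP; split=> -[s aut_s H]; exists s => //; last first.
  by rewrite /act -map_comp; apply: eq_map => k; rewrite -H.
move=> k; move: H; rewrite /act -map_comp => /eq_in_map/(_ k) ->//.
by rewrite mem_enum.
Qed.

(** By homogeneity, being conjugate to [y] means having the type of [y]; if the lengths differ,
    [Bot] excludes everything. *)
Lemma tclosed_conj (X : Type) (y : seq A) (ts : seq X) :
  tclosed (fun e : X -> A => conj y (map e ts)).
Proof.
have [yts|yts] := eqVneq (size y) (size ts); last first.
  exists [set Bot L _] => e; split=> [/conj_size|/(_ _ erefl)//].
  by rewrite size_map => /eqP; rewrite (negbTE yts).
pose t : (size ts).-tuple A := Tuple (introT eqP yts).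
have yE : y = map (tnth t) (enum 'I_(size ts)) by rewrite map_tnth_enum.
have tsE (e : X -> A) : map e ts = map (e \o tnth (in_tuple ts)) (enum 'I_(size
  ts)).
  by rewrite map_comp map_tnth_enum.
pose r (v : 'I_(size ts) * Lam) := (tnth (in_tuple ts) v.1, v.2).
exists [set q | exists2 p, sat p (fun v => tnth t v.1 v.2) & q = rename r p] =>
  e.
rewrite yE tsE conj_mapP; split=> [H _ [p Hp ->]|H p].
  by apply/sat_rename; exact: (H p).1.
split=> Hp; first by have /sat_rename := H _ (ex_intro2 _ _ p Hp erefl).
apply: contrapT => nHp.
by have /sat_rename := H _ (ex_intro2 _ _ (Neg p) nHp erefl); apply.
Qed.

(** * Conjugacy of lists of hyperimaginaries *)

Variable E : A -> A -> Prop.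
Hypothesis Eequiv : type_definable_equivalence E.

Lemma E_refl x : E x x. Proof. by case: Eequiv => -[H _ _] _; exact: H. Qed.
Lemma E_sym x y : E x y -> E y x.
Proof. by case: Eequiv => -[_ H _] _; exact: H. Qed.
Lemma E_trans x y z : E x y -> E y z -> E x z.
Proof. by case: Eequiv => -[_ _ H] _; exact: H. Qed.

Lemma E_aut s x y : automorphism s -> E x y -> E (s \o x) (s \o y).
Proof.
case: Eequiv => _ [F HF] aut_s /HF H; apply/HF => p /H /(sat_aut aut_s).
by rewrite (_ : s \o pair_env x y = pair_env (s \o x) (s \o y)) //;
  apply/funext => -[].
Qed.

Lemma tclosed_E (X : Type) (x x' : X) :
  tclosed (fun e : X -> A => E (e x) (e x')).
Proof.
case: Eequiv => _ [F HF].
pose r (v : Lam + Lam) := match v with inl l => (x, l) | inr l => (x', l) end.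
exists (rename r @` F) => e; rewrite HF.
have rE : pair_env (fun l => e (x, l)) (fun l => e (x', l)) = e \o r.
  by apply/funext => -[].
rewrite rE; split=> [H _ [p Fp <-]|H p Fp]; first exact/sat_rename/H.
by apply/sat_rename/H; exists p.
Qed.

Local Notation EL := (List.Forall2 E).

Lemma EL_refl y : EL y y.
Proof. by elim: y => [|b y IH]; constructor=> //; exact: E_refl. Qed.
Lemma EL_sym y z : EL y z -> EL z y.
Proof. by elim=> [|b c ? ? H _ IH]; constructor=> //; exact: E_sym. Qed.
Lemma EL_trans y z w : EL y z -> EL z w -> EL y w.
Proof.
move=> H; elim: H w => [|b c y' z' bc _ IH] w //.
move=> H; have [d [w' [-> cd zw]]] := Forall2_consl H.
by constructor; [exact: E_trans bc cd|exact: IH].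
Qed.
Lemma EL_act s y z : automorphism s -> EL y z -> EL (act s y) (act s z).
Proof. by move=> aut_s; elim=> [|b c ? ? H _ IH] /=; constructor=> //; exact:
  E_aut. Qed.

(** This is conjugacy of the two lists of [E]-classes, expressed on representatives. *)
Definition hconj (y y' : seq A) :=
  exists2 s, automorphism s & EL (act s y) y'.

Lemma conj_hconj y y' : conj y y' -> hconj y y'.
Proof. by move=> [s aut_s ->]; exists s => //; exact: EL_refl. Qed.

Lemma EL_hconj y y' : EL y y' -> hconj y y'.
Proof. by move=> H; exists id; [exact: aut_id|rewrite /act map_id]. Qed.

Lemma hconj_trans y y' y'' : hconj y y' -> hconj y' y'' -> hconj y y''.
Proof.
move=> [s aut_s H] [t aut_t H']; exists (t \o s); first exact: aut_comp.
by rewrite -act_comp; apply: EL_trans H'; exact: EL_act.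
Qed.

Lemma hconj_sym y y' : hconj y y' -> hconj y' y.
Proof.
move=> [s aut_s H]; have [s' [aut_s' sK _]] := aut_inv aut_s.
exists s' => //; have := EL_sym (EL_act aut_s' H); rewrite act_comp.
rewrite (_ : act _ y = y) // /act -[RHS]map_id; apply: eq_map => b.
by apply/funext => l /=; rewrite sK.
Qed.

Lemma hconj_mask m y y' : hconj y y' -> hconj (mask m y) (mask m y').
Proof.
by move=> [s aut_s H]; exists s; rewrite // act_mask; exact: Forall2_mask.
Qed.

Lemma hconj_lift y y' : hconj y y' -> exists2 z, conj y z & EL z y'.
Proof. by move=> [s aut_s H]; exists (act s y) => //; exists s. Qed.

(** Conjugacy up to [E] means that some entrywise [E]-equivalent list is conjugate to [y], which is
    a projection of a closed condition. *)
Lemma tclosed_hconj (X : Type) (y : seq A) (ts : seq X) : small K [set: X] ->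
  tclosed (fun e : X -> A => hconj y (map e ts)).
Proof.
move=> sX; pose n := size ts.
pose C (e : X + 'I_n -> A) := conj y (map e (map inr (enum 'I_n))) /\
  forall k : 'I_n, E (e (inr k)) (e (inl (tnth (in_tuple ts) k))).
have cC : tclosed C.
  apply: tclosed_and; first exact: tclosed_conj.
  by apply: tclosed_forall => k; exact: tclosed_E.
have sI : small K [set: 'I_n].
  by apply: (@small_inj _ _ _ (@nat_of_ord n)) (small_nat Mmonster); exact:
    ord_inj.
have [F HF] := tclosed_proj Mmonster sLam sX sI cC.
exists F => e; rewrite -HF; move: {HF F cC} (fun x l => _) => {}e.
have tsE (f : X -> A) : map f ts = map (f \o tnth (in_tuple ts)) (enum 'I_n).
  by rewrite map_comp map_tnth_enum.
split=> [/hconj_lift[z cz Ez]|[f []]]; last first.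
  rewrite -map_comp => /conj_hconj cf Ef; apply: hconj_trans cf _.
  by apply: EL_hconj; rewrite tsE; apply: Forall2_map => k _; exact: Ef.
have zn : size z = n by rewrite (Forall2_size Ez) size_map.
pose t : n.-tuple A := Tuple (introT eqP zn).
exists (tnth t); split.
  have tE : z = map (tnth t) (enum 'I_n) by rewrite map_tnth_enum.
  by rewrite -map_comp; move: cz; rewrite [X in conj _ X]tE.
have [x0] := dom_inhabited M; pose d : A := fun=> x0.
move=> k /=; rewrite (tnth_nth d) /=.
have kn : (k < size z)%N by rewrite zn.
have := @Forall2_nth _ _ _ d d _ _ k Ez kn.
rewrite tsE (nth_map k) ?size_enum_ord //= nth_ord_enum.
by [].
Qed.

End Conjugacy.

(** * Increasing lists and Ehrenfeucht-Mostowski types *)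

Lemma cat_inv (X : Type) (s1 s2 t1 t2 : seq X) :
  s1 ++ s2 = t1 ++ t2 -> size s1 = size t1 -> s1 = t1 /\ s2 = t2.
Proof. by elim: s1 t1 => [|x s1 IH] [|y t1] //= [-> /IH H] [/H[-> ->]]. Qed.

Lemma Forall2_cat_inv (X Y : Type) (r : X -> Y -> Prop) s1 s2 t1 t2 :
  size s1 = size t1 -> List.Forall2 r (s1 ++ s2) (t1 ++ t2) ->
  List.Forall2 r s1 t1 /\ List.Forall2 r s2 t2.
Proof.
move=> z H; have [u1 [u2 [/cat_inv e H1 H2]]] := Forall2_catl H.
by have [|-> ->] := e; first by rewrite -z (Forall2_size H1).
Qed.

Section Order.
Variables (d : Order.disp_t) (I : orderType d).
Implicit Types (l : seq I) (D : set I).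
Definition srt l := pairwise (<%O : rel I) l.

Lemma srtE l : srt l = sorted <%O l.
Proof. by rewrite /srt sorted_pairwise //; exact: lt_trans. Qed.

Definition inset l D := forall x, x \in l -> D x.

Lemma inset_cat l l' D : inset l D -> inset l' D -> inset (l ++ l') D.
Proof. by move=> lD l'D x; rewrite mem_cat => /orP[/lD|/l'D]. Qed.

Lemma srt_mask m l : srt l -> srt (mask m l).
Proof. exact: pairwise_mask. Qed.

Lemma srt_cat l l' : srt l -> srt l' -> (forall x y, x \in l -> y \in l' ->
  (x < y)%O) ->
  srt (l ++ l').
Proof. rewrite /srt => H H' ll'; rewrite pairwise_cat H H' !andbT;
  exact/allrelP. Qed.

Lemma srt_sub l l' : srt l -> srt l' -> {subset l <= l'} -> sublist l l'.
Proof.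
move=> sl sl' ll'; exists (map (mem l) l'); first by rewrite size_map.
rewrite -filter_mask; apply: lt_sorted_eq; rewrite -?srtE //.
  by rewrite /srt pairwise_filter.
by move=> x; rewrite mem_filter /=; case: (boolP (x \in l)) => // /ll' ->.
Qed.

Lemma srt_merge l l' : srt l -> srt l' -> exists l'',
  [/\ srt l'', {subset l <= l''}, {subset l' <= l''} &
      forall D, inset l D -> inset l' D -> inset l'' D].
Proof.
move=> sl sl'; exists (sort <=%O (undup (l ++ l'))); split.
- by rewrite srtE sort_lt_sorted undup_uniq.
- by move=> x xl; rewrite mem_sort mem_undup mem_cat xl.
- by move=> x xl; rewrite mem_sort mem_undup mem_cat xl orbT.
- move=> D lD l'D x; rewrite mem_sort mem_undup mem_cat.
  by case/orP => [/lD|/l'D].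
Qed.

Definition initial D := forall x y, D y -> (x < y)%O -> D x.

(** In a linear order this is what infinite cofinality of a set amounts to. *)
Definition openup D := (exists x, D x) /\ forall x, D x ->
  exists2 y, D y & (x < y)%O.
Definition opendown D := (exists x, D x) /\ forall x, D x ->
  exists2 y, D y & (y < x)%O.

Lemma openup_chain D l n : openup D -> inset l D -> exists l',
  [/\ srt l', size l' = n, inset l' D & forall x y, x \in l -> y \in l' ->
    (x < y)%O].
Proof.
move=> [[x0 Dx0] up] lD.
have [z Dz lz] : exists2 z, D z & forall x, x \in l -> (x < z)%O.
  elim: l lD => [|x l IH] lD; first by exists x0.
  have [y yl|z Dz lz] := IH; first by apply: lD; rewrite inE yl orbT.
  have [u Du xu] := up _ (lD x (mem_head _ _)).
  have [zu|uz] := leP z u.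
    exists u => // y; rewrite inE => /orP[/eqP->//|/lz yz].
    exact: lt_le_trans yz zu.
  exists z => // y; rewrite inE => /orP[/eqP->|/lz//].
  exact: lt_trans xu uz.
suff [l' [sl' zl' l'D]] : exists l', [/\ srt (z ::
  l'), size l' = n & inset l' D].
  move: sl'; rewrite /srt /= => /andP[/allP zl sl'].
  exists l'; split=> // x y /lz xz /zl; exact: lt_trans.
elim: n z Dz {lz} => [|n IH] z Dz; first by exists [::]; split=> // x.
have [y Dy zy] := up _ Dz; have [l' [sl' sz l'D]] := IH y Dy.
exists (y :: l'); split=> /=; [|by rewrite sz|].
  move: (sl'); rewrite /srt /= zy => /andP[/allP yl ->]; rewrite !andbT.
  by apply/andP; split; [apply/allP => x /yl; exact: lt_trans|apply/allP].
by move=> x; rewrite inE => /orP[/eqP->//|/l'D].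
Qed.

Lemma opendown_chain D l n : opendown D -> inset l D -> exists l',
  [/\ srt l', size l' = n, inset l' D & forall x y, x \in l -> y \in l' ->
    (y < x)%O].
Proof.
move=> [[x0 Dx0] up] lD.
have [z Dz lz] : exists2 z, D z & forall x, x \in l -> (z < x)%O.
  elim: l lD => [|x l IH] lD; first by exists x0.
  have [y yl|z Dz lz] := IH; first by apply: lD; rewrite inE yl orbT.
  have [u Du xu] := up _ (lD x (mem_head _ _)).
  have [zu|uz] := leP u z.
    exists u => // y; rewrite inE => /orP[/eqP->//|/lz yz].
    exact: le_lt_trans zu yz.
  exists z => // y; rewrite inE => /orP[/eqP->|/lz//].
  exact: lt_trans uz xu.
suff [l' [sl' zl' l'D]] : exists l', [/\ srt (rcons l' z), size l' = n & inset
  l' D].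
  move: sl'; rewrite /srt pairwise_rcons => /andP[/allP zl sl'].
  exists l'; split=> // x y /lz xz /zl yz; exact: lt_trans yz xz.
elim: n z Dz {lz} => [|n IH] z Dz; first by exists [::]; split=> // x.
have [y Dy zy] := up _ Dz; have [l' [sl' sz l'D]] := IH y Dy.
exists (rcons l' y); split=> /=; [|by rewrite size_rcons sz|].
  rewrite /srt pairwise_rcons -/(srt _) sl' andbT all_rcons zy /=.
  move: sl'; rewrite /srt pairwise_rcons => /andP[/allP yl _].
  by apply/allP => x /yl xy; exact: lt_trans xy zy.
by move=> x; rewrite mem_rcons inE => /orP[/eqP->//|/l'D].
Qed.

Lemma initial_lt D x y : initial D -> D x -> ~ D y -> (x < y)%O.
Proof.
move=> iD Dx nDy; rewrite ltNge; apply/negP; rewrite le_eqVlt.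
by case/orP => [/eqP yx|yx]; apply: nDy; [rewrite yx|exact: iD Dx yx].
Qed.

Lemma srt_split D l : initial D -> srt l -> exists l1 l2,
  [/\ l = l1 ++ l2, srt l1, srt l2, inset l1 D & inset l2 (~` D)].
Proof.
move=> iD sl; exists [seq x <- l | `[< D x >]], [seq x <- l | ~~ `[< D x >]].
have s1 : srt [seq x <- l | `[< D x >]] by rewrite /srt pairwise_filter.
have s2 : srt [seq x <- l | ~~ `[< D x >]] by rewrite /srt pairwise_filter.
split=> //.
- apply: lt_sorted_eq; rewrite -?srtE //; last first.
    by move=> x; rewrite mem_cat !mem_filter; case: asboolP; rewrite ?orbF.
  apply: srt_cat => // x y; rewrite !mem_filter => /andP[/asboolP Dx _].
  by move=> /andP[/asboolP nDy _]; exact: initial_lt Dx nDy.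
- by move=> x; rewrite mem_filter => /andP[/asboolP].
- by move=> x; rewrite mem_filter => /andP[/asboolP].
Qed.

End Order.

Section EhrenfeuchtMostowski.
Variables (L : language) (T : theory L) (K : Type) (M : structure L).
Hypothesis Mmonster : monster T K M.
Variable Lam : Type.
Hypothesis sLam : small K [set: Lam].
Local Notation A := (Lam -> M).
Variable E : A -> A -> Prop.
Hypothesis Eequiv : type_definable_equivalence E.
Local Notation EL := (List.Forall2 E).
Local Notation hconj := (hconj E).

Variables (d : Order.disp_t) (I : orderType d) (a : I -> A).
Hypothesis aindisc : forall l l', srt l -> srt l' -> size l = size l' ->
  conj (map a l) (map a l').
Hypothesis Iinf : forall n, exists2 l : seq I, srt l & size l = n.

(** [EMseq] says that [y] realizes the Ehrenfeucht-Mostowski type of [a]; [hEMseq] is goodness of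
    the list of classes of [y]. *)
Definition EMseq (y : seq A) := exists2 l, srt l & conj (map a l) y.
Definition hEMseq (y : seq A) := exists2 l, srt l & hconj (map a l) y.

Lemma EMseq_srt l : srt l -> EMseq (map a l).
Proof. by exists l => //; exact: conj_refl. Qed.

Lemma EMseq_conj y y' : EMseq y -> EMseq y' -> size y = size y' -> conj y y'.
Proof.
move=> [l sl cl] [l' sl' cl'] yy'; have zl := conj_size cl.
have zl' := conj_size cl'; rewrite !size_map in zl zl'.
apply: conj_trans (conj_sym cl) (conj_trans _ cl').
by apply: aindisc; rewrite ?zl ?zl'.
Qed.

Lemma EMseq_hEMseq y : EMseq y -> hEMseq y.
Proof. by move=> [l sl cl]; exists l => //; exact: conj_hconj. Qed.

Lemma hEMseq_trans y y' : hEMseq y -> hconj y y' -> hEMseq y'.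
Proof. by move=> [l sl cl] yy'; exists l => //; exact: hconj_trans cl yy'. Qed.

Lemma hEMseq_EL y y' : EL y y' -> hEMseq y -> hEMseq y'.
Proof. by move=> /EL_hconj yy' /hEMseq_trans; apply. Qed.

Lemma hEMseq_lift y : hEMseq y -> exists2 z, EMseq z & EL z y.
Proof. by move=> [l sl /hconj_lift[z cz Ez]]; exists z => //; exists l. Qed.

Lemma hEMseq_hconj y y' : hEMseq y -> hEMseq y' -> size y = size y' ->
  hconj y y'.
Proof.
move=> /hEMseq_lift[z Mz zy] /hEMseq_lift[z' Mz' zy'] yy'.
apply: (hconj_trans Eequiv) (EL_hconj (EL_sym Eequiv zy)) _.
apply: (hconj_trans Eequiv) (EL_hconj zy').
apply/(conj_hconj Eequiv)/EMseq_conj => //.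
by rewrite (Forall2_size zy) (Forall2_size zy').
Qed.

Lemma EMseq_sub y y' : sublist y y' -> EMseq y' -> EMseq y.
Proof.
move=> [m _ ->] [l sl cl]; exists (mask m l); first exact: srt_mask.
by rewrite map_mask; exact: conj_mask.
Qed.

Lemma hEMseq_sub y y' : sublist y y' -> hEMseq y' -> hEMseq y.
Proof.
move=> [m _ ->] [l sl cl]; exists (mask m l); first exact: srt_mask.
by rewrite map_mask; exact: hconj_mask.
Qed.

(** All increasing lists of one length are conjugate by indiscernibility, so the existential over
    [l] reduces to one fixed list. *)
Lemma tclosed_EMseq (X : Type) (ts : seq X) :
  tclosed (fun e : X -> A => EMseq (map e ts)).
Proof.
have [l sl zl] := Iinf (size ts).
have [F HF] := tclosed_conj Mmonster sLam (map a l) ts; exists F => e.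
rewrite -HF; split=> [He|]; last by exists l.
by apply: EMseq_conj => //; [exact: EMseq_srt|rewrite !size_map].
Qed.

Lemma tclosed_hEMseq (X : Type) (ts : seq X) : small K [set: X] ->
  tclosed (fun e : X -> A => hEMseq (map e ts)).
Proof.
move=> sX; have [l sl zl] := Iinf (size ts).
have [F HF] := tclosed_hconj Mmonster sLam Eequiv (map a l) ts sX; exists F =>
  e.
rewrite -HF; split=> [He|]; last by exists l.
by apply: hEMseq_hconj => //; [exact/EMseq_hEMseq/EMseq_srt|rewrite !size_map].
Qed.

End EhrenfeuchtMostowski.

(** * Failing pairs and shattering *)

Definition flat (X : Type) (s : seq (X * X)) : seq X :=
  flatten [seq [:: p.1; p.2] | p <- s].

Lemma flat_rcons (X : Type) (s : seq (X * X)) x y :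
  flat (rcons s (x, y)) = flat s ++ [:: x; y].
Proof. by rewrite /flat map_rcons flatten_rcons. Qed.

Lemma sublist_flat (X : Type) (b : bitseq) (s : seq (X * X)) :
  size b = size s ->
  sublist [seq (if q.1 then q.2.1 else q.2.2) | q <- zip b s] (flat s).
Proof.
elim: s b => [|[x y] s IH] [|[] b] //=; first by move=> _; exact: sublist_nil.
  by move=> [bs]; apply/sublist_cons/sublist_skip1/IH.
by move=> [bs]; apply/sublist_skip1/sublist_cons/IH.
Qed.

Lemma Forall2_flat (X Y : Type) (r : X -> Y -> Prop) z s :
  List.Forall2 r z (flat s) -> exists2 s', z = flat s' &
    List.Forall2 (fun p q => r p.1 q.1 /\ r p.2 q.2) s' s.
Proof.
elim: s z => [|[x y] s IH] z H.
  by exists [::]; [inversion H|constructor].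
inversion H as [|x' ? z' ? rx H']; subst.
inversion H' as [|y' ? z'' ? ry H'']; subst.
have [s' -> Hs] := IH _ H''.
by exists ((x', y') :: s') => //; constructor.
Qed.

Lemma Forall2_catr (X Y : Type) (r : X -> Y -> Prop) s t1 t2 :
  List.Forall2 r s (t1 ++ t2) -> exists s1 s2,
    [/\ s = s1 ++ s2, List.Forall2 r s1 t1 & List.Forall2 r s2 t2].
Proof.
elim: t1 s => [|y t1 IH] s H; first by exists [::], s; split=> //; constructor.
inversion H as [|x ? s' ? rxy H']; subst.
have [s1 [s2 [-> H1 H2]]] := IH _ H'.
by exists (x :: s1), s2; split=> //; constructor.
Qed.

Lemma Forall2_In (X Y : Type) (r : X -> Y -> Prop) s t x :
  List.Forall2 r s t -> List.In x s -> exists2 y, List.In y t & r x y.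
Proof.
move=> H; elim: H x => [|a b s' t' rab _ IH] x //= [<-|/IH[y yt rxy]].
  by exists b => //; left.
by exists y => //; right.
Qed.

Lemma Forall2_sublist1 (X Y : Type) (r : X -> Y -> Prop) s t y :
  List.Forall2 r s t -> List.In y t -> exists2 x, sublist [:: x] s & r x y.
Proof.
move=> H; elim: H y => [|a b s' t' rab _ IH] y //= [<-|/IH[x xs rxy]].
  by exists a => //; exact/sublist_cons/sublist_nil.
by exists x => //; exact: sublist_skip1.
Qed.

Lemma In_mem (X : eqType) (x : X) s : List.In x s <-> x \in s.
Proof.
elim: s => //= y s ->; rewrite inE.
by split=> [[->|->]|/orP[/eqP->|xs]]; rewrite ?eqxx ?orbT //; [left|right].
Qed.

Lemma In_nth (X : Type) (x0 : X) s n : n < size s -> List.In (nth x0 s n) s.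
Proof. by elim: s n => //= x s IH [|n] ns; [left|right; exact: IH]. Qed.

Section Shatter.
Variables (L : language) (T : theory L) (K : Type) (M : structure L).
Hypotheses (TNIP : NIP T) (Mmonster : monster T K M).
Variable Lam : Type.
Hypothesis sLam : small K [set: Lam].
Local Notation A := (Lam -> M).
Variable E : A -> A -> Prop.
Hypothesis Eequiv : type_definable_equivalence E.
Local Notation EL := (List.Forall2 E).

Variables (d : Order.disp_t) (I : orderType d) (a : I -> A).
Hypothesis aindisc : forall l l', srt l -> srt l' -> size l = size l' ->
  conj (map a l) (map a l').
Hypothesis Iinf : forall n, exists2 l : seq I, srt l & size l = n.
Local Notation EMseq := (EMseq a).
Local Notation hEMseq := (hEMseq E a).

(** * Bounded alternation *)

Lemma tdefinable_aut (X : Type) (D : (X -> A) -> Prop) (s : M -> M) e :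
  tdefinable D -> automorphism s -> D (fun x => s \o e x) <-> D e.
Proof.
move=> [p Hp] aut_s; have H f : D f <-> sat p (fun v =>
  f v.1 v.2) by rewrite -Hp.
by rewrite !H -[X in _ <-> X](sat_aut aut_s).
Qed.

(** Disjoint consecutive pairs are counted because the pairs to come consist of a reserve point,
    where [G] holds, followed by an inserted point, where it fails. *)
Definition alternation_bound (G : A -> Prop) B := forall s, size s = B ->
  EMseq (flat s) -> ~ forall p, List.In p s -> G p.1 /\ ~ G p.2.

(** [N] alternating pairs would shatter [N] points: for a pattern [S], keep from the n-th pair the
    member at which [G] has truth value [S n]. The resulting lists are all conjugate to the one for
    [xpredT], and moving [e] along realizes every pattern on that single list. *)
Lemma NIP_alternation (X : Type) (G : (option X -> A) -> Prop) : tdefinable G ->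
  exists B, forall e : X -> A, alternation_bound (fun x => G (extend e x)) B.
Proof.
move=> dG; apply: contrapT => /forallNP nB.
pose r (o : option X) : unit + X := if o is Some x then inr x else inl tt.
apply: (NIP_no_shatter Mmonster TNIP (tdefinable_reindex r dG)) => N.
have /existsNP[e /existsNP[s]] := nB N.
move=> /not_implyP[sN /not_implyP[Es /contrapT Gs]].
pose z (S : nat -> bool) :=
  [seq (if q.1 then q.2.1 else q.2.2) | q <- zip (map S (iota 0 N)) s].
have zE S : EMseq (z S).
  by apply: EMseq_sub Es; apply: sublist_flat; rewrite size_map size_iota.
have zz S : size (z S) = N by rewrite size_map size1_zip size_map size_iota ?sN.
have /choice[t Ht] : forall S, exists t, automorphism t /\
  z xpredT = act t (z S).
  move=> S; have [|t aut_t zt] := EMseq_conj aindisc (zE S) (zE xpredT).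
    by rewrite !zz.
  by exists t.
have [x0] := dom_inhabited M; pose b : A := fun=> x0.
exists (fun n _ => nth b (z xpredT) n), (fun S x => t S \o e x) => S n nN.
have [aut_t zt] := Ht S.
have -> : pair_env (fun=> nth b (z xpredT) n) (fun x => t S \o e x) \o r =
    (fun o => t S \o extend e (nth b (z S) n) o).
  apply/funext => -[x|] //=; rewrite zt /act (nth_map b) ?zz //.
rewrite (tdefinable_aut _ dG aut_t) /z.
rewrite (nth_map (true, (b, b))) ?size1_zip ?size_map ?size_iota ?sN //.
rewrite nth_zip ?size_map ?size_iota ?sN //= (nth_map 0) ?size_iota //.
rewrite nth_iota // add0n.
have /Gs[G1 G2] : List.In (nth (b, b) s n) s by apply: In_nth; rewrite sN.
by case: (S n); split.
Qed.

(** [Nf] abstracts the failing lists: parameters left of, between and right of the cuts, together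
    with a pair. [N_insert] produces failing pairs at prescribed places of any good list; [N_distal]
    is what distality says about real representatives. *)
Variables (n1 n2 n3 : nat) (Nf : seq A -> Prop).
Hypothesis Ncl : forall (X : Type) (ts : seq X), small K [set: X] ->
  tclosed (fun e : X -> A => Nf (map e ts)).
Hypothesis N_EL : forall w w', EL w w' -> Nf w -> Nf w'.
Hypothesis N_insert : forall g1 w1 w2 g2 v1 v2 g3,
  size g1 = n1 -> size g2 = n2 -> size g3 = n3 ->
  hEMseq (g1 ++ w1 ++ w2 ++ g2 ++ v1 ++ v2 ++ g3) -> exists x y,
  [/\ hEMseq (g1 ++ w1 ++ x :: w2 ++ g2 ++ v1 ++ v2 ++ g3),
      hEMseq (g1 ++ w1 ++ w2 ++ g2 ++ v1 ++ y :: v2 ++ g3)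
    & Nf (g1 ++ x :: g2 ++ y :: g3)].
Hypothesis N_distal : forall g1 g2 g3 x y,
  size g1 = n1 -> size g2 = n2 -> size g3 = n3 ->
  EMseq (g1 ++ x :: g2 ++ g3) -> EMseq (g1 ++ g2 ++ y :: g3) ->
  ~ Nf (g1 ++ x :: g2 ++ y :: g3).

(** A good list consists of arbitrary representatives. Requiring the alternation on whole classes
    makes it survive in a lift that realizes the Ehrenfeucht-Mostowski type. *)
Lemma alternation_boundE G B s : alternation_bound G B -> size s = B ->
  (forall p, List.In p s -> (forall x, E p.1 x -> G x) /\
                            (forall x, E p.2 x -> ~ G x)) ->
  ~ hEMseq (flat s).
Proof.
move=> GB sB Gs /hEMseq_lift[z + zs]; have [s' -> Hs] := Forall2_flat zs.
move=> /GB; apply; first by rewrite (Forall2_size Hs).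
move=> p ps'; have [q qs [E1 E2]] := Forall2_In Hs ps'.
have [G1 G2] := Gs q qs.
by split; [apply: G1|apply: G2]; exact: (E_sym Eequiv).
Qed.

(* Failing pairs are inserted one after the other; were G or G' to fail at each
   of them, the inserted points would alternate with those of W or W'. *)
Lemma base_change G G' B B' g1 g2 g3 W W' :
  alternation_bound G B -> alternation_bound G' B' ->
  size g1 = n1 -> size g2 = n2 -> size g3 = n3 ->
  size W = B -> size W' = B' ->
  (forall w, List.In w W -> forall x, E w x -> G x) ->
  (forall w, List.In w W' -> forall x, E w x -> G' x) ->
  hEMseq (g1 ++ W ++ g2 ++ W' ++ g3) ->
  exists x y, [/\ Nf (g1 ++ x :: g2 ++ y :: g3), G x & G' y].
Proof.
move=> GB GB' z1 z2 z3.
pose good H p := (forall x, E p.1 x -> H x) /\ (forall x, E p.2 x -> ~ H x) :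
  Prop.
suff loop n : forall s1 r1 s2 r2, size r1 + size r2 = n ->
    size s1 + size r1 = B -> size s2 + size r2 = B' ->
    (forall p, List.In p s1 -> good G p) -> (forall p, List.In p s2 ->
      good G' p) ->
    (forall w, List.In w r1 -> forall x, E w x -> G x) ->
    (forall w, List.In w r2 -> forall x, E w x -> G' x) ->
    hEMseq (g1 ++ (flat s1 ++ r1) ++ g2 ++ (flat s2 ++ r2) ++ g3) ->
    exists x y, [/\ Nf (g1 ++ x :: g2 ++ y :: g3), G x & G' y].
  move=> zW zW' GW GW' RW.
  by apply: (loop _ [::] W [::] W').
elim: n => [|n IH] s1 [|w r1] s2 [|w' r2] //=.
- move=> _; rewrite addn0 => zs1 _ Gs1 _ _ _ RW; exfalso.
  apply: (alternation_boundE GB zs1 Gs1); apply: hEMseq_sub RW.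
  by apply/sublist_skip/sublist_skipr/sublist_skipr/sublist_refl.
- move=> _; rewrite addn0 => zs1 _ Gs1 _ _ _ RW; exfalso.
  apply: (alternation_boundE GB zs1 Gs1); apply: hEMseq_sub RW.
  by apply/sublist_skip/sublist_skipr/sublist_skipr/sublist_refl.
- move=> _ _; rewrite addn0 => zs2 _ Gs2 _ _ RW; exfalso.
  apply: (alternation_boundE GB' zs2 Gs2); apply: hEMseq_sub RW.
  apply/sublist_skip/sublist_skip/sublist_skip/sublist_skipr/sublist_skipr.
  exact: sublist_refl.
rewrite !addSn !addnS => -[zn] zs1 zs2 Gs1 Gs2 Gr1 Gr2 RW.
have [||||x [y [Rx Ry Nxy]]] :=
    @N_insert g1 (flat s1 ++ [:: w]) r1 g2 (flat s2 ++ [:: w']) r2 g3 => //.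
  by rewrite -!catA /=; move: RW; rewrite -!catA.
(* On failure only the offending point is kept and its partner is discarded, since nothing ensures
   that both can be inserted together. *)
have [[x' xx' Gx']|nGx] := pselect (exists2 x', E x x' & G x'); last first.
  apply: (IH (rcons s1 (w, x)) r1 s2 (w' :: r2)) => //=.
  - by rewrite addnS.
  - by rewrite size_rcons addSn.
  - by rewrite addnS.
  - move=> p; rewrite -cats1 => /List.in_app_iff[/Gs1//|[<-|//]].
    by split=> [z|z xz Gz] /=; [apply: Gr1; left|apply: nGx; exists z].
  - by move=> v vr; apply: Gr1; right.
  by rewrite flat_rcons; move: Rx; rewrite -!catA /= -?catA.
have [[y' yy' Gy']|nGy] := pselect (exists2 y', E y y' & G' y').
  exists x', y'; split=> //; apply: N_EL Nxy.
  by apply: Forall2_cat; [exact: EL_refl|constructor=> //; apply: Forall2_cat;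
    [exact: EL_refl|constructor=> //; exact: EL_refl]].
apply: (IH s1 (w :: r1) (rcons s2 (w', y)) r2) => //=.
- by rewrite addnS.
- by rewrite size_rcons addSn.
- move=> p; rewrite -cats1 => /List.in_app_iff[/Gs2//|[<-|//]].
  by split=> [z|z yz Gz] /=; [apply: Gr2; left|apply: nGy; exists z].
- by move=> v vr; apply: Gr2; right.
by rewrite flat_rcons; move: Ry; rewrite -!catA /= -?catA.
Qed.

(* Indices of the points of a configuration: (0, _), (1, _), (2, _) for the
   parameters, (3, n) and (4, n) for the n-th failing pair, (5, _) and (6, _)
   for the points kept in reserve on the right of each cut. *)
Definition blk c n : seq (nat * nat) := [seq (c, i) | i <- iota 0 n].

Definition ix m p k := blk 0 n1 ++ mask m (blk 3 p) ++ blk 5 k ++ blk 1 n2 ++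
  mask (map negb m) (blk 4 p) ++ blk 6 k ++ blk 2 n3.

Definition jx n := blk 0 n1 ++ (3, n) :: blk 1 n2 ++ (4, n) :: blk 2 n3.

(** The mask [m] is the set S of the overview: it keeps first components where it is true and second
    components elsewhere. The parameters and the pairs are the same for all masks. *)
Definition configuration p k (e : nat * nat -> A) :=
  (forall m, size m = p -> hEMseq (map e (ix m p k))) /\
  (forall n, n < p -> Nf (map e (jx n))).

Lemma size_blk c n : size (blk c n) = n.
Proof. by rewrite size_map size_iota. Qed.

Lemma mem_blk c n x : (x \in blk c n) = (x.1 == c) && (x.2 < n).
Proof.
apply/mapP/idP => [[i]|]; first by rewrite mem_iota => ni -> /=; rewrite eqxx.
by case: x => c' i /= /andP[/eqP-> ni]; exists i; rewrite ?mem_iota.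
Qed.

Lemma blkD c n m : blk c (n + m) = blk c n ++ [seq (c, n + i) | i <- iota 0 m].
Proof.
by rewrite /blk iotaD add0n map_cat -[X in iota X m]addn0 iotaDl -map_comp.
Qed.

Lemma blkS c n : blk c n.+1 = blk c n ++ [:: (c, n)].
Proof. by rewrite -addn1 blkD /= addn0. Qed.

Lemma map_blk (b : A) (e : nat * nat -> A) c (s : seq A) :
  (forall i, e (c, i) = nth b s i) -> map e (blk c (size s)) = s.
Proof.
move=> H; rewrite -[RHS](mkseq_nth b) /mkseq /blk -map_comp.
by apply: eq_map => i /=; rewrite H.
Qed.

Lemma configuration0 k : exists e, configuration 0 k e.
Proof.
have [l sl zl] := Iinf (n1 + (k + (n2 + (k + n3)))).
have Rl := EMseq_hEMseq Eequiv (EMseq_srt a sl).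
move: (map a l) (size_map a l) Rl => y; rewrite zl => zy Ry.
have [x0] := dom_inhabited M; pose b : A := fun=> x0.
have cut n m (z : seq A) : size z = n + m -> exists z1 z2,
    [/\ z = z1 ++ z2, size z1 = n & size z2 = m].
  move=> zz; exists (take n z), (drop n z); rewrite cat_take_drop size_take.
  rewrite size_drop zz addKn; split=> //; case: ltnP => //.
  by rewrite -[X in _ <= X]addn0 leq_add2l leqn0 => /eqP->; rewrite addn0.
have [y1 [r1 [yE zy1 zr1]]] := cut _ _ _ zy.
have [y2 [r2 [r1E zy2 zr2]]] := cut _ _ _ zr1.
have [y3 [r3 [r2E zy3 zr3]]] := cut _ _ _ zr2.
have [y4 [y5 [r3E zy4 zy5]]] := cut _ _ _ zr3.
exists (fun x => nth b (nth [::] [:: y1; y3; y5; [::]; [::]; y2; y4] x.1) x.2).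
split=> // -[|//] _; rewrite /ix /= !map_cat.
rewrite -[in blk 0 _]zy1 -[in blk 5 _]zy2 -[in blk 1 _]zy3 -[in blk 6 _]zy4.
rewrite -[in blk 2 _]zy5 !(map_blk (b := b)) //.
by rewrite -r3E -r2E -r1E -yE.
Qed.

(** The new pair must fail over the old parameters, and each of its points must fit at its cut for
    all old patterns at once. If no pair did so, there would be formulas [Gx] and [Gy], implied by
    the two fitting conditions, that no failing pair satisfies together. Reserve points fit, hence
    satisfy these formulas, and [base_change] produces a forbidden pair. *)
Lemma configurationS p : (forall k, exists e, configuration p k e) ->
  forall k, exists e, configuration p.+1 k e.
Proof.
move=> IH k.
pose pm m := blk 0 n1 ++ mask m (blk 3 p).
pose qm m := blk 1 n2 ++ mask (map negb m) (blk 4 p).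
pose dx m := map Some (pm m) ++ None :: map Some (blk 5 k ++ qm m ++ blk 6 k ++
  blk 2 n3).
pose dy m := map Some (pm m ++ blk 5 k ++ qm m) ++ None :: map Some (blk 6 k ++
  blk 2 n3).
(* In the double option, [None] is the new first point and [Some None] the new second one; [rx] and
   [ry] each forget the other. *)
pose rx (o : option (nat * nat)) : option (option (nat * nat)) :=
  if o is Some t then Some (Some t) else None.
pose ry (o : option (nat * nat)) : option (option (nat * nat)) :=
  if o is Some t then Some (Some t) else Some None.
pose SS (t : nat * nat) := Some (Some t).
pose Dx (e : option (nat * nat) -> A) := forall m, size m = p ->
  hEMseq (map e (dx m)).
pose Dy (e : option (nat * nat) -> A) := forall m, size m = p ->
  hEMseq (map e (dy m)).
pose Nz (e : option (option (nat * nat)) -> A) :=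
  Nf (map e (map SS (blk 0 n1) ++ None :: map SS (blk 1 n2) ++
             Some None :: map SS (blk 2 n3))) /\
  (forall n, n < p -> Nf (map e (map SS (jx n)))).
have sP : small K [set: (nat * nat)%type].
  by apply: (monster_small_prod Mmonster); exact: small_nat Mmonster.
have sO := small_option Mmonster sP; have sZ := small_option Mmonster sO.
have cDx : tclosed Dx.
  by do 2 apply: tclosed_forall => ?; exact: (tclosed_hEMseq Mmonster sLam
    Eequiv aindisc Iinf).
have cDy : tclosed Dy.
  by do 2 apply: tclosed_forall => ?; exact: (tclosed_hEMseq Mmonster sLam
    Eequiv aindisc Iinf).
have cNz : tclosed Nz.
  by apply: tclosed_and; [exact: Ncl|do 2 apply: tclosed_forall => ?; exact:
    Ncl].
have [[e [[Ne Nj] Hx Hy]]|none] :=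
    pselect (exists e, [/\ Nz e, Dx (e \o rx) & Dy (e \o ry)]).
  pose e' (t : nat * nat) := if t == (3, p) then e None
    else if t == (4, p) then e (Some None) else e (SS t).
  have e'E s : (3, p) \notin s -> (4, p) \notin s ->
    map e' s = map e (map SS s).
    move=> s3 s4; rewrite -map_comp; apply/eq_in_map => t ts; rewrite /e'.
    case: eqP => [tE|_]; first by rewrite -tE ts in s3.
    by case: eqP => [tE|_] //; rewrite -tE ts in s4.
  have e3 : e' (3, p) = e None by rewrite /e' eqxx.
  have e4 : e' (4, p) = e (Some None) by rewrite /e' eqxx.
  have bE c n : c != 3 -> c != 4 -> map e' (blk c n) = map e (map SS (blk c n)).
    by move=> c3 c4; rewrite e'E // mem_blk /= eq_sym ?(negbTE c3) ?(negbTE c4).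
  have mE c m : c \in [:: 3; 4] -> map e' (mask m (blk c p)) =
      map e (map SS (mask m (blk c p))).
    move=> _; rewrite e'E //; apply/negP => /mem_mask;
    by rewrite mem_blk /= ltnn andbF.
  exists e'; split=> [m|n].
    case/lastP: m => // m b; rewrite size_rcons => -[zm].
    rewrite /ix !blkS map_rcons -!cats1.
    rewrite !mask_cat ?size_map ?size_iota //.
    case: b => /=; rewrite ?cats0 !map_cat /= ?e3 ?e4 !bE // !mE //.
      by have := Hx m zm; rewrite /dx /pm /qm map_comp -!map_comp /= !map_cat /=
        !map_cat -!map_comp -!catA.
    by have := Hy m zm; rewrite /dy /pm /qm map_comp -!map_comp /= !map_cat /=
      !map_cat -!map_comp -!catA.
  rewrite ltnS leq_eqVlt => /orP[/eqP->|np].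
    move: Ne; rewrite /jx !map_cat /= e3 !map_cat /= e4 !bE //.
  have := Nj n np; rewrite /jx -e'E //;
  by rewrite mem_cat !inE mem_cat !inE !mem_blk /= !xpair_eqE /= ?(gtn_eqF np).
exfalso.
have cNy : tclosed (fun e => Nz e /\ Dy (e \o ry)).
  by apply: tclosed_and => //; exact: tclosed_reindex.
(* [Dx] is enlarged to a formula first; [Dy] is then separated from the failing pairs satisfying
   that formula, so that in the end both conditions are formulas. *)
have [|Gx dGx [DGx nGx]] := tseparate Mmonster sLam (r := rx) sZ cNy cDx.
  by move=> e [Ne De] Dxe; apply: none; exists e.
have cNx : tclosed (fun e => Nz e /\ Gx (e \o rx)).
  by apply: tclosed_and => //; apply/tclosed_reindex/tclosed_tdefinable.
have [|Gy dGy [DGy nGy]] := tseparate Mmonster sLam (r := ry) sZ cNx cDy.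
  by move=> e [Ne Ge] De; apply: (nGx e).
have [B HB] := NIP_alternation dGx; have [B' HB'] := NIP_alternation dGy.
(* [B] reserve points are spent at the first cut, [B'] at the second, and [k] must remain at each.
   Reserving [B + B'] at both cuts allows the same index shift in [e1], which retains the last
   [k]. *)
have [e [Re Ne]] := IH (B + B' + k).
pose e1 (t : nat * nat) := if (t.1 == 5) || (t.1 == 6) then e (t.1, B + B' +
  t.2) else e t.
have e1E c n : c != 5 -> c != 6 -> map e1 (blk c n) = map e (blk c n).
  move=> c5 c6; apply/eq_in_map => t; rewrite mem_blk /e1 => /andP[/eqP-> _].
  by rewrite (negbTE c5) (negbTE c6).
have e1M c m n : c != 5 -> c != 6 -> map e1 (mask m (blk c n)) = map e (mask m
  (blk c n)).
  by move=> c5 c6; rewrite !map_mask e1E.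
have e1W c : (c == 5) || (c == 6) ->
    map e1 (blk c k) = map e [seq (c, B + B' + i) | i <- iota 0 k].
  by move=> c56; rewrite /blk -!map_comp; apply: eq_map => i;
    rewrite /= /e1 /= c56.
have split5 j : j < B + B' -> forall c, sublist ((c, j) ::
  [seq (c, B + B' + i) | i <- iota 0 k])
    (blk c (B + B' + k)).
  move=> jB c; rewrite blkD -cat1s; apply: sublist_cat (sublist_refl _).
  rewrite -(subnKC jB) blkD; apply: sublist_skipr; rewrite blkS.
  exact/sublist_skip/sublist_refl.
suff [x [y [Nxy Gxx Gyy]]] : exists x y, [/\ Nf (map e (blk 0 n1) ++ x ::
    map e (blk 1 n2) ++ y :: map e (blk 2 n3)),
    Gx (extend e1 x) & Gy (extend e1 y)].
  pose eZ := extend (extend e1 y) x.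
  have eZx : eZ \o rx = extend e1 x by apply/funext => -[].
  have eZy : eZ \o ry = extend e1 y by apply/funext => -[].
  have eZS s : map eZ (map SS s) = map e1 s by rewrite -map_comp.
  apply: (nGy eZ); rewrite ?eZx ?eZy //; split=> //; split.
    by rewrite !map_cat /= !map_cat /= !eZS !e1E.
  move=> n np; rewrite eZS; have := Ne n np; rewrite /jx.
  by rewrite !map_cat /= !map_cat /= !e1E.
apply: (base_change (HB e1) (HB' e1) (W := map e (blk 5 B))
  (W' := map e (blk 6 B'))); rewrite ?size_map ?size_iota //.
- move=> w /List.in_map_iff[t [<- /In_mem]]; rewrite mem_blk => /andP[].
  case: t => c j /= /eqP-> jB x wx; apply: DGx => m zm.
  have jBB : j < B + B' by apply: leq_trans jB (leq_addr _ _).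
  rewrite /dx map_cat -map_comp map_cons -map_comp.
  apply: (@hEMseq_EL _ _ _ _ Eequiv _ _ _ (map e1 (pm m) ++ e (5, j) ::
    map e1 (blk 5 k ++ qm m ++ blk 6 k ++ blk 2 n3))).
    by apply: Forall2_cat; [exact: EL_refl|constructor=> //; exact: EL_refl].
  apply: hEMseq_sub (Re m zm); rewrite /ix /pm /qm !map_cat -!catA.
  rewrite (e1W 5) // (e1W 6) // !e1E // !e1M // -!map_cat -!map_cons -!map_cat.
  apply: sublist_map; do 2 apply: sublist_cat (sublist_refl _) _.
  rewrite -cat_cons; apply: sublist_cat; first exact: split5.
  do 2 apply: sublist_cat (sublist_refl _) _.
  apply: sublist_cat (sublist_refl _).
  by rewrite blkD; exact/sublist_skip/sublist_refl.
- move=> w /List.in_map_iff[t [<- /In_mem]]; rewrite mem_blk => /andP[].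
  case: t => c j /= /eqP-> jB y wy; apply: DGy => m zm.
  have jBB : j < B + B' by apply: leq_trans jB (leq_addl _ _).
  rewrite /dy map_cat -map_comp map_cons -map_comp.
  apply: (@hEMseq_EL _ _ _ _ Eequiv _ _ _ (map e1 (pm m ++ blk 5 k ++ qm m) ++
    e (6, j) ::
    map e1 (blk 6 k ++ blk 2 n3))).
    by apply: Forall2_cat; [exact: EL_refl|constructor=> //; exact: EL_refl].
  apply: hEMseq_sub (Re m zm); rewrite /ix /pm /qm !map_cat -!catA.
  rewrite (e1W 5) // (e1W 6) // !e1E // !e1M // -!map_cat -!map_cons -!map_cat.
  apply: sublist_map; do 2 apply: sublist_cat (sublist_refl _) _.
  apply: sublist_cat; first by rewrite blkD; exact/sublist_skip/sublist_refl.
  do 2 apply: sublist_cat (sublist_refl _) _.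
  by rewrite -cat_cons; apply: sublist_cat (sublist_refl _); exact: split5.
(* The choice of pattern is immaterial, as all old pairs are dropped from the list. *)
- have := Re (nseq p true); rewrite size_nseq => /(_ erefl).
  apply: hEMseq_sub; rewrite /ix -!map_cat; apply: sublist_map.
  apply: sublist_cat (sublist_refl _) _; apply: sublist_skip.
  apply: sublist_cat.
    by rewrite -addnA blkD; exact/sublist_skipr/sublist_refl.
  apply: sublist_cat (sublist_refl _) _; apply: sublist_skip.
  apply: sublist_cat (sublist_refl _).
  by rewrite (addnC B) -addnA blkD; exact/sublist_skipr/sublist_refl.
Qed.

Lemma configuration_exists p k : exists e, configuration p k e.
Proof.
elim: p k => [|p IH] k; [exact: configuration0|exact: configurationS].
Qed.

(* A lift of the points of a configuration selected by S admits a lift of the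
   first component of the n-th pair if n is in S, and of the second one
   otherwise; by distality it cannot admit both. *)
Lemma no_configurations : False.
Proof.
have sP : small K [set: (nat * nat)%type].
  by apply: (monster_small_prod Mmonster); exact: small_nat Mmonster.
have sO := small_option Mmonster sP.
have sU : small K [set: unit].
  by apply: (@small_inj _ _ _ (fun=> 0)) (small_nat Mmonster) => -[] [].
have sOU := small_sum Mmonster sO sU.
pose iS (t : nat * nat) : option (nat * nat) + unit := inl (Some t).
(* [inl None] is the first component of a pair. Once [inr tt] is projected out, [CP] says that its
   class has a representative fitting at the first cut, and [CQ] that some point completing a
   failing list fits at the second cut. *)
pose CP (h : option (nat * nat) + unit -> A) := E (h (inr tt)) (h (inl None)) /\
  EMseq (map h (map iS (blk 0 n1) ++ inr tt :: map iS (blk 1 n2 ++ blk 2 n3))).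
pose CQ (h : option (nat * nat) + unit -> A) :=
  EMseq (map h (map iS (blk 0 n1 ++ blk 1 n2) ++ inr tt ::
    map iS (blk 2 n3))) /\
  Nf (map h (map iS (blk 0 n1) ++ inl None :: map iS (blk 1 n2) ++
             inr tt :: map iS (blk 2 n3))).
have cCP : tclosed CP.
  apply: tclosed_and; first exact: tclosed_E.
  exact: (tclosed_EMseq Mmonster sLam aindisc Iinf).
have cCQ : tclosed CQ.
  by apply: tclosed_and; [exact: (tclosed_EMseq Mmonster sLam aindisc
    Iinf)|exact: Ncl].
have cP := tclosed_proj Mmonster sLam sO sU cCP.
have cQ := tclosed_proj Mmonster sLam sO sU cCQ.
(* The two conditions exclude each other by [N_distal]; the separating formula [G] is the one shown
   to have the independence property. *)
have [|G dG [PG QG]] := tseparate Mmonster sLam (r := id) sO cQ cP.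
  move=> e [f [Ef Nf1]] [g [Eg Eg']].
  pose J c n := map e (map Some (blk c n)).
  apply: (@N_distal (J 0 n1) (J 1 n2) (J 2 n3) (g tt) (f tt));
    rewrite /J -?map_comp ?size_map ?size_iota //.
  - by move: Eg'; rewrite !map_cat /= !map_cat -!map_comp.
  - by move: Ef; rewrite !map_cat /= -!map_comp -!catA.
  move: Nf1; rewrite !map_cat /= !map_cat /= -!map_comp; apply: N_EL.
  apply: Forall2_cat; first exact: EL_refl.
  constructor; first exact: (E_sym Eequiv).
  by apply: EL_refl.
pose r (o : option (nat * nat)) : unit + nat * nat :=
  if o is Some x then inr x else inl tt.
apply: (NIP_no_shatter Mmonster TNIP (tdefinable_reindex r dG)) => p.
have [e [Re Ne]] := configuration_exists p 0.
have [x0] := dom_inhabited M; pose b : A := fun=> x0.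
have maskE c (S : pred nat) :
    mask (map S (iota 0 p)) (blk c p) = [seq (c, i) | i <- iota 0 p & S i].
  by rewrite /blk -map_mask -filter_mask.
have /choice[v Hv] : forall S : nat -> bool, exists v : nat * nat -> A,
    forall n, n < p -> G (pair_env (fun _ : unit => e (3, n)) v \o r) <-> S n.
  move=> S; have := Re (map S (iota 0 p)); rewrite size_map size_iota.
  move=> /(_ erefl)/hEMseq_lift[z Ez]; rewrite /ix !map_cat /=.
  rewrite -map_comp maskE (maskE 4 (negb \o S)) => zE.
  have [z1 [r1 [z_E z1E r1E]]] := Forall2_catr zE.
  have [z2 [r2 [r1_E z2E r2E]]] := Forall2_catr r1E.
  have [z3 [r3 [r2_E z3E r3E]]] := Forall2_catr r2E.
  have [z4 [z5 [r3_E z4E z5E]]] := Forall2_catr r3E.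
  have zz1 : size z1 = n1 by rewrite (Forall2_size z1E) size_map size_blk.
  have zz3 : size z3 = n2 by rewrite (Forall2_size z3E) size_map size_blk.
  have zz5 : size z5 = n3 by rewrite (Forall2_size z5E) size_map size_blk.
  pose v (t : nat * nat) := nth b (nth [::] [:: z1; z3; z5] t.1) t.2.
  have v1 : map v (blk 0 n1) = z1 by rewrite -zz1 (map_blk (b := b)).
  have v3 : map v (blk 1 n2) = z3 by rewrite -zz3 (map_blk (b := b)).
  have v5 : map v (blk 2 n3) = z5 by rewrite -zz5 (map_blk (b := b)).
  exists v => n np.
  have vS f s : map (pair_env (pair_env (fun=> e (3, n)) v \o r) f) (map iS s) =
      map v s by rewrite -map_comp.
  case Sn : (S n); split=> //.
    move=> _; apply: PG.
    have [|x xz2 Ex] := Forall2_sublist1 (y := e (3, n)) z2E.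
      apply/List.in_map_iff; exists (3, n); split=> //; apply/In_mem.
      by apply/mapP; exists n; rewrite // mem_filter Sn mem_iota.
    exists (fun=> x); split=> //=.
    rewrite !map_cat /= !map_cat !vS v1 v3 v5.
    apply: EMseq_sub Ez; rewrite z_E r1_E r2_E r3_E -cat1s.
    apply: sublist_cat (sublist_refl _) _; apply: sublist_cat xz2 _.
    apply: sublist_cat (sublist_refl _) _; exact/sublist_skip/sublist_refl.
  move=> HG; exfalso; apply: (QG (pair_env (fun=> e (3, n)) v \o r) _ HG).
  have [|y yz4 Ey] := Forall2_sublist1 (y := e (4, n)) z4E.
    apply/List.in_map_iff; exists (4, n); split=> //; apply/In_mem.
    by apply/mapP; exists n; rewrite // mem_filter /= Sn mem_iota.
  exists (fun=> y); split=> /=.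
    rewrite !map_cat /= !vS v1 v3 v5 -!catA.
    apply: EMseq_sub Ez; rewrite z_E r1_E r2_E r3_E -cat1s.
    apply: sublist_cat (sublist_refl _) _; apply: sublist_skip.
    apply: sublist_cat (sublist_refl _) _; exact: sublist_cat (sublist_refl _).
  rewrite !map_cat /= !map_cat /= !vS v1 v3 v5.
  have := Ne n np; rewrite /jx !map_cat /= !map_cat /=; apply: N_EL.
  apply: Forall2_cat; first exact: EL_sym.
  constructor; first exact: E_refl.
  apply: Forall2_cat; first exact: EL_sym.
  by constructor; [exact: E_sym|exact: EL_sym].
by exists (fun n _ => e (3, n)), v => S n np; exact: Hv.
Qed.

End Shatter.

(** * Lifting two fillings *)

Section Cuts.
Variables (L : language) (T : theory L) (K : Type) (M : structure L).
Hypotheses (TNIP : NIP T) (Mmonster : monster T K M).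
Variable Lam : Type.
Hypothesis sLam : small K [set: Lam].
Local Notation A := (Lam -> M).
Variable E : A -> A -> Prop.
Hypothesis Eequiv : type_definable_equivalence E.
Local Notation EL := (List.Forall2 E).

Variables (d : Order.disp_t) (I : orderType d) (a : I -> A).
Hypothesis sI : small K [set: I].
Hypothesis aindisc : forall l l', srt l -> srt l' -> size l = size l' ->
  conj (map a l) (map a l').
Local Notation EMseq := (EMseq a).
Local Notation hEMseq := (hEMseq E a).
Local Notation hconj := (hconj E).

Variables D1 D2 : set I.
Hypotheses (iD1 : initial D1) (iD2 : initial D2) (D12 : D1 `<=` D2).
Hypothesis D12x : exists2 c, D2 c & ~ D1 c.
Hypotheses (uD1 : openup D1) (dD1 : opendown (~` D1)).
Hypotheses (uD2 : openup D2) (dD2 : opendown (~` D2)).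

Lemma cut_infinite n : exists2 l : seq I, srt l & size l = n.
Proof.
have [|l [sl zl _ _]] := @openup_chain _ _ D1 [::] n uD1; first by [].
by exists l.
Qed.
Let Iinf := cut_infinite.

Definition admissible (l : seq I * seq I * seq I) :=
  [/\ srt l.1.1, srt l.1.2 & srt l.2] /\
  [/\ inset l.1.1 D1, inset l.1.2 (D2 `\` D1) & inset l.2 (~` D2)].

(* inr true and inr false stand for the points filling the cuts D1 and D2. *)
Definition tl (l : seq I * seq I * seq I) : seq (I + bool) :=
  map inl l.1.1 ++ inr true :: map inl l.1.2 ++ inr false :: map inl l.2.
Definition tx (l : seq I * seq I * seq I) : seq (I + bool) :=
  map inl l.1.1 ++ inr true :: map inl (l.1.2 ++ l.2).
Definition ty (l : seq I * seq I * seq I) : seq (I + bool) :=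
  map inl (l.1.1 ++ l.1.2) ++ inr false :: map inl l.2.

Variable fab : bool -> A.
Local Notation e0 := (pair_env a fab).
Hypothesis fill1 : forall l1 l2, srt l1 -> srt l2 -> inset l1 D1 ->
  inset l2 (~` D1) -> hEMseq (map a l1 ++ fab true :: map a l2).
Hypothesis fill2 : forall l1 l2, srt l1 -> srt l2 -> inset l1 D2 ->
  inset l2 (~` D2) -> hEMseq (map a l1 ++ fab false :: map a l2).
Hypothesis distal : forall f : bool -> A,
  (forall l1 l2, srt l1 -> srt l2 -> inset l1 D1 ->
     inset l2 (~` D1) -> EMseq (map a l1 ++ f true :: map a l2)) ->
  (forall l1 l2, srt l1 -> srt l2 -> inset l1 D2 ->
     inset l2 (~` D2) -> EMseq (map a l1 ++ f false :: map a l2)) ->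
  forall l, admissible l -> EMseq (map (pair_env a f) (tl l)).

Lemma admissible_merge l l' : admissible l -> admissible l' -> exists2 l'',
  admissible l'' & [/\ sublist (tl l) (tl l''), sublist (tl l') (tl l''),
    sublist (tx l) (tx l''), sublist (tx l') (tx l'') &
    sublist (ty l) (ty l'') /\ sublist (ty l') (ty l'')].
Proof.
move: l l' => [[l1 l2] l3] [[k1 k2] k3] [[/= s1 s2 s3] [/= i1 i2 i3]].
move=> [[/= t1 t2 t3] [/= j1 j2 j3]].
have [m1 [u1 lm1 km1 im1]] := srt_merge s1 t1.
have [m2 [u2 lm2 km2 im2]] := srt_merge s2 t2.
have [m3 [u3 lm3 km3 im3]] := srt_merge s3 t3.
exists (m1, m2, m3).
  by split; split=> //=; [exact: im1|exact: im2|exact: im3].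
have sub (p1 p2 p3 : seq I) : sublist p1 m1 -> sublist p2 m2 -> sublist p3 m3 ->
    [/\ sublist (tl (p1, p2, p3)) (tl (m1, m2, m3)),
        sublist (tx (p1, p2, p3)) (tx (m1, m2, m3))
      & sublist (ty (p1, p2, p3)) (ty (m1, m2, m3))].
  move=> h1 h2 h3; rewrite /tl /tx /ty /= !map_cat; split.
  - apply: sublist_cat (sublist_map _ h1) (sublist_cons _ _).
    exact: sublist_cat (sublist_map _ h2) (sublist_cons _ (sublist_map _ h3)).
  - apply: sublist_cat (sublist_map _ h1) (sublist_cons _ _).
    exact: sublist_cat (sublist_map _ h2) (sublist_map _ h3).
  - apply: sublist_cat (sublist_cons _ (sublist_map _ h3)).
    exact: sublist_cat (sublist_map _ h1) (sublist_map _ h2).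
have [A1 A2 A3] := sub l1 l2 l3 (srt_sub s1 u1 lm1) (srt_sub s2 u2 lm2) (srt_sub
  s3 u3 lm3).
have [B1 B2 B3] := sub k1 k2 k3 (srt_sub t1 u1 km1) (srt_sub t2 u2 km2) (srt_sub
  t3 u3 km3).
by split.
Qed.

(** Otherwise compactness over the fixed representatives [a] gives one [f] for all [l]. Its points
    fill both cuts of (a_i), so distality makes [tl i] good when read with [f]; but that list is
    conjugate up to [E] to the one read with [e0], which is not good. *)
Lemma distal_finite i : admissible i -> ~ hEMseq (map e0 (tl i)) ->
  exists2 l, admissible l & forall f : bool -> A,
    EMseq (map (pair_env a f) (tx l)) -> EMseq (map (pair_env a f) (ty l)) ->
    ~ hconj (map e0 (tl l)) (map (pair_env a f) (tl l)).
Proof.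
move=> ai nRi; apply: contrapT => none.
have {}none l : admissible l -> exists f : bool -> A,
    [/\ EMseq (map (pair_env a f) (tx l)), EMseq (map (pair_env a f) (ty l)) &
    hconj (map e0 (tl l)) (map (pair_env a f) (tl l))].
  move=> al; apply: contrapT => nf; apply: none; exists l => // f fx fy fl.
  by apply: nf; exists f.
have sB : small K [set: bool].
  by apply: (@small_inj _ _ _ nat_of_bool) (small_nat Mmonster) => -[] [].
have sIB := small_sum Mmonster sI sB.
pose C (l : {l | admissible l}) (e : I + bool -> A) :=
  EMseq (map e (tx (sval l))) /\ (EMseq (map e (ty (sval l))) /\
  hconj (map e0 (tl (sval l))) (map e (tl (sval l)))).
have [||f Hf] := tcompact (C := C) (e0 := a) Mmonster sLam sI sB.
- move=> l; do 2?apply: tclosed_and.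
  + exact: (tclosed_EMseq Mmonster sLam aindisc Iinf).
  + exact: (tclosed_EMseq Mmonster sLam aindisc Iinf).
  + exact: (tclosed_hconj Mmonster sLam Eequiv).
- move=> s; have [m am Hm] : exists2 m, admissible m & forall l, List.In l s ->
     [/\ sublist (tl (sval l)) (tl m), sublist (tx (sval l)) (tx m) &
         sublist (ty (sval l)) (ty m)].
    elim: s => [|[l al] s [m am Hm]]; first by exists i => // l [].
    have [m' am' [H1 H2 H3 H4 [H5 H6]]] := admissible_merge al am.
    exists m' => // k [<-//|/Hm[K1 K2 K3]].
    by split; [exact: sublist_trans K1 H2|exact: sublist_trans K2 H4|
               exact: sublist_trans K3 H6].
  have [f [fx fy fl]] := none m am; exists f => l /Hm[[b _ H1] H2 H3].
  split; first by apply: EMseq_sub fx; exact: sublist_map.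
  split; first by apply: EMseq_sub fy; exact: sublist_map.
  by rewrite H1 !map_mask; exact: hconj_mask.
apply: nRi.
have [_ [_ /(hconj_sym Eequiv)]] := Hf (exist _ i ai); apply: hEMseq_trans =>
  //.
apply: (EMseq_hEMseq Eequiv); apply: distal ai => l1 l2 s1 s2 i1 i2.
  have [k1 [k2 [kE t1 t2 j1 j2]]] := srt_split iD2 s2.
  have al : admissible (l1, k1, k2).
    split; split=> //= x xk; split; first exact: j1.
    by apply: i2; rewrite kE mem_cat xk.
  have [+ _] := Hf (exist _ _ al); rewrite /tx /= map_cat /= -!map_comp -kE.
  exact.
have [k1 [k2 [kE t1 t2 j1 j2]]] := srt_split iD1 s1.
have al : admissible (k1, k2, l2).
  split; split=> //= x xk; split; last exact: j2.
  by apply: i1; rewrite kE mem_cat xk orbT.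
have [_ [+ _]] := Hf (exist _ _ al); rewrite /ty /= map_cat /= -!map_comp -kE.
exact.
Qed.

(** * Properties of failing lists *)

Section Insert.
Variable l : seq I * seq I * seq I.
Hypothesis al : admissible l.
Local Notation l1 := l.1.1.
Local Notation l2 := l.1.2.
Local Notation l3 := l.2.
(** The whole orbit of the original bad list counts, which is why failing pairs can be found inside
    every good list. *)
Definition failing (w : seq A) := hconj (map e0 (tl l)) w.

(** Dedekind cuts leave room for an increasing list of indices with the prescribed numbers on each
    side. An automorphism matches it with the given good list up to [E] and carries alpha and beta
    along. *)
Lemma failing_insert g1 w1 w2 g2 v1 v2 g3 :
  size g1 = size l1 -> size g2 = size l2 -> size g3 = size l3 ->
  hEMseq (g1 ++ w1 ++ w2 ++ g2 ++ v1 ++ v2 ++ g3) -> exists x y,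
  [/\ hEMseq (g1 ++ w1 ++ x :: w2 ++ g2 ++ v1 ++ v2 ++ g3),
      hEMseq (g1 ++ w1 ++ w2 ++ g2 ++ v1 ++ y :: v2 ++ g3)
    & failing (g1 ++ x :: g2 ++ y :: g3)].
Proof.
move=> zg1 zg2 zg3 HR; have [[s1 s2 s3] [i1 i2 i3]] := al.
(* The index [c] keeps the indices [p2] just above the first cut apart from the indices [q1] just
   below the second one, even if [l2] is empty. *)
have [c D2c nD1c] := D12x.
have [p1 [sp1 zp1 ip1 lp1]] := openup_chain (size w1) uD1 i1.
have [p2 [sp2 zp2 ip2 lp2]] : exists p, [/\ srt p, size p = size w2,
    inset p (~` D1) & forall x y, x \in c :: l2 -> y \in p -> (y < x)%O].
  apply: opendown_chain => // x; rewrite inE => /orP[/eqP->//|/i2[]//].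
have [q1 [sq1 zq1 iq1 lq1]] : exists p, [/\ srt p, size p = size v1,
    inset p D2 & forall x y, x \in c :: l2 -> y \in p -> (x < y)%O].
  apply: openup_chain => // x; rewrite inE => /orP[/eqP->//|/i2[]//].
have [q2 [sq2 zq2 iq2 lq2]] := opendown_chain (size v2) dD2 i3.
have p2D2 : inset p2 D2.
  by move=> x xp; apply: (iD2 D2c); apply: lp2 => //; exact: mem_head.
have q1D1 : inset q1 (~` D1).
  move=> x xq D1x; apply: nD1c; apply: (iD1 D1x); apply: lq1 => //.
  exact: mem_head.
have l2D1 : inset l2 (~` D1) by move=> x /i2[].
have l2D2 : inset l2 D2 by move=> x /i2[].
have l1D2 : inset l1 D2 by move=> x /i1; exact: D12.
have p1D2 : inset p1 D2 by move=> x /ip1; exact: D12.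
have q2D1 : inset q2 (~` D1) by move=> x /iq2 H /D12.
have l3D1 : inset l3 (~` D1) by move=> x /i3 H /D12.
have lt1 x y : D1 x -> ~ D1 y -> (x < y)%O by exact: initial_lt.
have lt2 x y : D2 x -> ~ D2 y -> (x < y)%O by exact: initial_lt.
have sL : srt (l1 ++ p1) by apply: srt_cat.
have sR : srt (q2 ++ l3) by apply: srt_cat => // x y xq yl; exact: lq2.
have sM : srt (p2 ++ l2 ++ q1).
  apply: srt_cat => //; first by apply: srt_cat => // x y xl; apply: lq1;
    rewrite inE xl orbT.
  move=> x y xp; rewrite mem_cat => /orP[yl|yq].
    by apply: lp2; rewrite // inE yl orbT.
  apply: (@lt_trans _ _ c); first by apply: lp2; rewrite // mem_head.
  by apply: lq1; rewrite // mem_head.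
have sMR : srt ((p2 ++ l2 ++ q1) ++ q2 ++ l3).
  apply: srt_cat => // x y xM yR; apply: lt2.
    by move: x xM; do 2 apply: inset_cat => //.
  by move: y yR; apply: inset_cat.
have sLM : srt ((l1 ++ p1) ++ p2 ++ l2 ++ q1).
  apply: srt_cat => // x y xL yM; apply: lt1.
    by move: x xL; apply: inset_cat.
  by move: y yM; do 2 apply: inset_cat => //.
have sall : srt ((l1 ++ p1) ++ (p2 ++ l2 ++ q1) ++ q2 ++ l3).
  apply: srt_cat => // x y xL; rewrite mem_cat => /orP[yM|yR].
    apply: lt1; first by move: x xL; apply: inset_cat.
    by move: y yM; do 2 apply: inset_cat => //.
  apply: lt1; first by move: x xL; apply: inset_cat.
  by move: y yR; apply: inset_cat.
have Rall := EMseq_hEMseq Eequiv (EMseq_srt a sall).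
have [|s aut_s] := hEMseq_hconj Eequiv aindisc Rall HR.
  by rewrite size_map !size_cat zg1 zg2 zg3 zp1 zp2 zq1 zq2 !addnA.
have za (u : seq I) : size (act s (map a u)) = size u by rewrite !size_map.
rewrite -!catA !map_cat !act_cat.
move=> /(Forall2_cat_inv _)[]; first by rewrite za.
move=> H1 /(Forall2_cat_inv _)[]; first by rewrite za.
move=> H2 /(Forall2_cat_inv _)[]; first by rewrite za.
move=> H3 /(Forall2_cat_inv _)[]; first by rewrite za.
move=> H4 /(Forall2_cat_inv _)[]; first by rewrite za.
move=> H5 /(Forall2_cat_inv _)[]; first by rewrite za.
move=> H6 H7.
exists (s \o fab true), (s \o fab false); split.
- apply: (hEMseq_trans Eequiv (fill1 sL sMR _ _)).
  + exact: inset_cat.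
  + by apply: inset_cat; [do 2 apply: inset_cat => //|exact: inset_cat].
  exists s => //; rewrite !map_cat /= !act_cat /= !act_cat -!catA.
  do 2 apply: Forall2_cat => //; constructor; first exact: E_refl.
  by do 4 apply: Forall2_cat => //.
- apply: (hEMseq_trans Eequiv (fill2 sLM sR _ _)).
  + by apply: inset_cat; [exact: inset_cat|do 2 apply: inset_cat => //].
  + exact: inset_cat.
  exists s => //; rewrite !map_cat /= !act_cat /= !act_cat -!catA.
  do 5 apply: Forall2_cat => //; constructor; first exact: E_refl.
  by apply: Forall2_cat => //.
exists s => //; rewrite /tl !map_cat /= !map_cat /= -!map_comp !act_cat /=
  !act_cat /=.
apply: Forall2_cat => //; constructor; first exact: E_refl.
by apply: Forall2_cat => //; constructor=> //; exact: E_refl.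
Qed.

Hypothesis distal_l : forall f : bool -> A,
    EMseq (map (pair_env a f) (tx l)) -> EMseq (map (pair_env a f) (ty l)) ->
    ~ hconj (map e0 (tl l)) (map (pair_env a f) (tl l)).

(** An automorphism moves the parameters onto the tuples [a] at the indices [l]; the images of [x]
    and [y] then form an [f] excluded by [distal_l]. *)
Lemma failing_distal g1 g2 g3 x y :
  size g1 = size l1 -> size g2 = size l2 -> size g3 = size l3 ->
  EMseq (g1 ++ x :: g2 ++ g3) -> EMseq (g1 ++ g2 ++ y :: g3) ->
  ~ failing (g1 ++ x :: g2 ++ y :: g3).
Proof.
move=> z1 z2 z3 Ex Ey Fxy; have [[s1 s2 s3] [i1 i2 i3]] := al.
have Eg : EMseq (g1 ++ g2 ++ g3).
  apply: EMseq_sub Ex; apply: sublist_cat (sublist_refl _) _.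
  exact/sublist_skip1/sublist_refl.
have sl : srt (l1 ++ l2 ++ l3).
  apply: srt_cat => //; first apply: srt_cat => //.
    by move=> u v /i2[H _] /i3; exact: initial_lt.
  move=> u v /i1 H; rewrite mem_cat => /orP[/i2[_]|/i3 H'].
    exact: initial_lt.
  by apply: (initial_lt iD1) => // /D12.
have [|s aut_s sE] := EMseq_conj aindisc Eg (EMseq_srt a sl).
  by rewrite size_map !size_cat z1 z2 z3.
move: sE; rewrite !map_cat !act_cat => /cat_inv[]; first by rewrite !size_map.
move=> e1 /cat_inv[]; first by rewrite !size_map.
move=> e2 e3.
pose f (b : bool) := if b then s \o x else s \o y.
have conjEM u : EMseq u -> EMseq (act s u).
  by move=> [k sk ck]; exists k => //; apply: conj_trans ck _; exists s.
apply: (distal_l (f := f)).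
- move/conjEM: Ex; rewrite /tx map_cat /= !map_cat -!map_comp !act_cat /=
  !act_cat.
  by rewrite -e1 -e2 -e3.
- move/conjEM: Ey; rewrite /ty map_cat /= !map_cat -!map_comp !act_cat /= -catA.
  by rewrite -e1 -e2 -e3.
apply: (hconj_trans Eequiv) Fxy _; exists s => //.
rewrite /tl map_cat /= map_cat /= -!map_comp !act_cat /= !act_cat /=.
rewrite -e1 -e2 -e3; exact: EL_refl.
Qed.

Lemma failing_contradiction : False.
Proof.
apply: (no_configurations TNIP Mmonster sLam Eequiv aindisc Iinf
  (Nf := failing) _ _ failing_insert failing_distal).
- by move=> X ts sX; exact: (tclosed_hconj Mmonster sLam Eequiv).
- by move=> w w' /EL_hconj ww' /(hconj_trans Eequiv); apply.
Qed.
End Insert.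

Lemma distal_lift i : admissible i -> hEMseq (map e0 (tl i)).
Proof.
move=> ai; apply: contrapT => nRi.
have [l al Hl] := distal_finite ai nRi.
exact: (failing_contradiction al Hl).
Qed.

End Cuts.

(** * Indiscernible sequences as families of lists *)

Section Increasing.
Variable S : Type.
Implicit Types s t : oseq S.

Definition inc s (l : seq (idx s)) := pairwise (fun x y => `[< olt x y >]) l.

Lemma inc_tnth s n (t : n.-tuple (idx s)) : inc t -> increasing (tnth t).
Proof.
move=> it j k jk; have x0 := tnth t j; rewrite !(tnth_nth x0).
apply/asboolP; apply: (elimT (pairwiseP x0) it) => //;
  by rewrite inE size_tuple.
Qed.

Lemma inc_map_enum s n (i : 'I_n -> idx s) : increasing i ->
  inc (map i (enum 'I_n)).
Proof.
move=> ii; rewrite /inc pairwise_map.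
have : pairwise (fun j k : 'I_n => j < k) (enum 'I_n).
  have := iota_ltn_sorted 0 n; rewrite sorted_pairwise; last exact: ltn_trans.
  by rewrite -val_enum_ord pairwise_map.
by apply: sub_pairwise => j k jk; apply/asboolP; exact: ii.
Qed.

Lemma inc_ocat s t l1 l2 : inc l1 -> inc l2 ->
  inc (s := ocat s t) (map inl l1 ++ map inr l2).
Proof.
move=> i1 i2; rewrite /inc pairwise_cat !pairwise_map.
apply/and3P; split; last 2 first.
- by move: i1; apply: sub_pairwise.
- by move: i2; apply: sub_pairwise.
rewrite /allrel all_map; apply/allT => x /=; rewrite all_map.
by apply/allT => y /=; apply/asboolP.
Qed.

Lemma ocat_inc s t (l : seq (idx (ocat s t))) : inc l ->
  exists l1 l2, [/\ l = map inl l1 ++ map inr l2, inc l1 & inc l2].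
Proof.
elim: l => [|x l IH]; first by exists [::], [::].
rewrite /inc /= => /andP[xl /IH[l1 [l2 [lE i1 i2]]]]; subst l => {IH}.
case: x xl => x xl.
  exists (x :: l1), l2; split=> //; rewrite /inc /= -/(inc l1) i1 andbT.
  by move: xl; rewrite all_cat all_map => /andP[xl _]; apply: sub_all xl.
case: l1 i1 xl => [|y l1] _ /=; last by move=> /andP[/asboolP].
move=> xl; exists [::], (x :: l2); split=> //;
  rewrite /inc /= -/(inc l2) i2 andbT.
by move: xl; rewrite all_map; apply: sub_all.
Qed.

Lemma osingle_inc (c : S) (l : seq (idx (osingle c))) : inc l ->
  l = [::] \/ l = [:: tt].
Proof.
case: l => [|[] [|[] l]] /=; [by left|by right|].
by rewrite /inc /= => /andP[/andP[/asboolP]].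
Qed.

End Increasing.

Section Codes.
Variables (d : Order.disp_t) (I : orderType d) (S : Type) (b : I -> S).

Lemma restr_list (D : set I) (l : seq I) : srt l -> inset l D ->
  exists2 l' : seq (idx (@orestr S (oseq_of b) D)), inc l' & map val l' = l.
Proof.
move=> sl lD; suff [l' l'E] : exists l' : seq D, map val l' = l.
  exists l' => //; move: sl; rewrite -l'E /srt /inc pairwise_map.
  by apply: sub_pairwise => x y xy; apply/asboolP.
elim: l lD {sl} => [|x l IH] lD; first by exists [::].
have [|l' <-] := IH; first by move=> y yl; apply: lD; rewrite inE yl orbT.
by exists (SigSub (mem_set (lD x (mem_head _ _))) :: l').
Qed.

Lemma list_restr (D : set I) (l : seq (idx (@orestr S (oseq_of b) D))) :
  inc l -> srt (map val l) /\ inset (map val l) D.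
Proof.
move=> il; split; last by move=> x /mapP[y _ ->]; exact: set_mem (valP y).
rewrite /srt pairwise_map; move: il; apply: sub_pairwise => x y.
by move=> /asboolP.
Qed.

Definition oseq3 (D : set I) (c : S) := ocat (@orestr S (oseq_of b) D)
  (ocat (osingle c) (@orestr S (oseq_of b) (~` D))).

Definition oseq5 (D1 D2 : set I) (c c' : S) := ocat (@orestr S (oseq_of b) D1)
  (ocat (osingle c) (ocat (@orestr S (oseq_of b) (D2 `\` D1))
  (ocat (osingle c') (@orestr S (oseq_of b) (~` D2))))).

(** Filled sequences are read over the common index type [I + bool], as in [tl]; [u] records which
    of the two cuts is filled. *)
Definition code3 D c (u : bool) (x : idx (oseq3 D c)) : I + bool :=
  match x with
  | inl i => inl (val i)
  | inr (inl _) => inr u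
  | inr (inr i) => inl (val i)
  end.

Definition code5 D1 D2 c c' (x : idx (oseq5 D1 D2 c c')) : I + bool :=
  match x with
  | inl i => inl (val i)
  | inr (inl _) => inr true
  | inr (inr (inl i)) => inl (val i)
  | inr (inr (inr (inl _))) => inr false
  | inr (inr (inr (inr i))) => inl (val i)
  end.

Lemma code3_inc D c u (l : seq (idx (oseq3 D c))) : inc l -> exists l1 l2,
  [/\ srt l1, srt l2, inset l1 D, inset l2 (~` D) &
      sublist (map (code3 u) l) (map inl l1 ++ inr u :: map inl l2)].
Proof.
move=> /ocat_inc[l1 [l' [-> c1 /ocat_inc[m [l2 [-> cm c2]]]]]].
have [s1 i1] := list_restr c1; have [s2 i2] := list_restr c2.
have mE := osingle_inc cm.
exists (map val l1), (map val l2); split=> //.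
rewrite !map_cat -!map_comp; apply: sublist_cat (sublist_refl _) _.
rewrite -cat1s; apply: sublist_cat (sublist_refl _).
by case: mE => -> /=; [exact: sublist_nil|exact: sublist_refl].
Qed.

Lemma inc_code3 D c u l1 l2 : srt l1 -> srt l2 -> inset l1 D ->
  inset l2 (~` D) ->
  exists2 l : seq (idx (oseq3 D c)), inc l &
    map (code3 u) l = map inl l1 ++ inr u :: map inl l2.
Proof.
move=> s1 s2 /(restr_list s1)[k1 ik1 <-] /(restr_list s2)[k2 ik2 <-].
exists (map inl k1 ++ map inr (map inl [:: tt] ++ map inr k2)).
  by do 2 apply: inc_ocat => //.
by rewrite !map_cat /= -!map_comp.
Qed.

(** Lists to the left of the filling involve (a_i) alone. Comparison with such a list of equal
    length shows that an arbitrary list of the filled sequence is good. *)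
Lemma inc_code3_left D c u l1 : srt l1 -> inset l1 D ->
  exists2 l : seq (idx (oseq3 D c)), inc l & map (code3 u) l = map inl l1.
Proof.
move=> s1 /(restr_list s1)[k1 ik1 <-].
exists (map inl k1 ++ map inr [::]); first exact: inc_ocat.
by rewrite cats0 -!map_comp.
Qed.

Lemma code5_inc D1 D2 c c' (l : seq (idx (oseq5 D1 D2 c c'))) : inc l ->
  exists2 k, admissible D1 D2 k & sublist (map (@code5 _ _ _ _) l) (tl k).
Proof.
move=> /ocat_inc[l1 [l' [-> c1 /ocat_inc[m [l'' [-> cm]]]]]].
move=> /ocat_inc[l2 [l3 [-> c2 /ocat_inc[m' [l4 [-> cm' c4]]]]]].
have [s1 i1] := list_restr c1; have [s2 i2] := list_restr c2.
have [s4 i4] := list_restr c4.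
have mE := osingle_inc cm; have mE' := osingle_inc cm'.
exists (map val l1, map val l2, map val l4); first by [].
rewrite /tl /= !map_cat -!map_comp; apply: sublist_cat (sublist_refl _) _.
rewrite -cat1s; apply: sublist_cat.
  by case: mE => -> /=; [exact: sublist_nil|exact: sublist_refl].
apply: sublist_cat (sublist_refl _) _.
rewrite -cat1s; apply: sublist_cat (sublist_refl _).
by case: mE' => -> /=; [exact: sublist_nil|exact: sublist_refl].
Qed.

Lemma inc_code5 D1 D2 c c' k : admissible D1 D2 k ->
  exists2 l : seq (idx (oseq5 D1 D2 c c')), inc l & map (@code5 _ _ _ _) l = tl
    k.
Proof.
move: k => [[l1 l2] l3] [[/= s1 s2 s3] [/= i1 i2 i3]].
have [k1 ik1 <-] := restr_list s1 i1; have [k2 ik2 <-] := restr_list s2 i2.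
have [k3 ik3 <-] := restr_list s3 i3.
exists (map inl k1 ++ map inr (map inl [:: tt] ++ map inr (map inl k2 ++
   map inr (map inl [:: tt] ++ map inr k3)))).
  by do 4 apply: inc_ocat => //.
by rewrite /tl !map_cat /= -!map_comp.
Qed.

Lemma inc_code5_left D1 D2 c c' l1 : srt l1 -> inset l1 D1 ->
  exists2 l : seq (idx (oseq5 D1 D2 c c')), inc l &
    map (@code5 _ _ _ _) l = map inl l1.
Proof.
move=> s1 /(restr_list s1)[k1 ik1 <-].
exists (map inl k1 ++ map inr [::]); first exact: inc_ocat.
by rewrite cats0 -!map_comp.
Qed.

Lemma inc_oseq_of (l : seq I) : inc (s := oseq_of b) l = srt l.
Proof. by apply: eq_pairwise => x y; rewrite /= asboolb. Qed.

(** An empty half would have the empty set as a cofinal set, and a half with an extreme element a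
    singleton; both are finite. *)
Lemma dedekind_cutP D : dedekind_cut (s := oseq_of b) D ->
  [/\ initial D, openup D & opendown (~` D)].
Proof.
move=> [iD cofD coD]; split=> //; split.
- apply: contrapT => nD; apply: (cofD set0) (finite_set0 _) => x.
  by case: nD; exists (val x); exact: set_mem (valP x).
- move=> x Dx; apply: contrapT => nx; pose xx : D := SigSub (mem_set Dx).
  apply: (cofD [set xx]) (finite_set1 _) => y; exists xx => //.
  have := @leP _ _ (val y) x; case=> [|xy]; last first.
    by case: nx; exists (val y) => //; exact: set_mem (valP y).
  by rewrite le_eqVlt => /orP[/eqP yx|]; [right; exact: val_inj|left].
- apply: contrapT => nD; apply: (coD set0) (finite_set0 _) => x.
  by case: nD; exists (val x); exact: set_mem (valP x).
- move=> x Dx; apply: contrapT => nx; pose xx : ~` D := SigSub (mem_set Dx).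
  apply: (coD [set xx]) (finite_set1 _) => y; exists xx => //.
  have := @leP _ _ x (val y); case=> [|xy]; last first.
    by case: nx; exists (val y) => //; exact: set_mem (valP y).
  by rewrite le_eqVlt => /orP[/eqP yx|]; [right; exact/val_inj/esym|left].
Qed.

End Codes.

Section Indiscernible.
Variables (L : language) (T : theory L) (K : Type) (M : structure L).
Hypothesis Mmonster : monster T K M.
Variable Lam : Type.
Hypothesis sLam : small K [set: Lam].
Local Notation A := (Lam -> M).

Lemma indiscernibleP (s : oseq A) : indiscernible s <->
  forall l l' : seq (idx s), inc l -> inc l' -> size l = size l' ->
  conj (map (@nthi _ s) l) (map (@nthi _ s) l').
Proof.
split=> [ind l l' il il' ll'|H n i j ii ij].
  pose t : (size l').-tuple _ := Tuple (introT eqP ll').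
  have lE : l = map (tnth t) (enum 'I_(size l')) by rewrite map_tnth_enum.
  have l'E : l' = map (tnth (in_tuple l')) (enum 'I_(size l')).
    by rewrite map_tnth_enum.
  have [_] := conj_mapP Mmonster sLam (@nthi _ s \o tnth t) (@nthi _ s \o tnth
    (in_tuple l')).
  rewrite (map_comp (@nthi _ s) (tnth t)) (map_comp (@nthi _ s) (tnth (in_tuple
    l'))).
  by rewrite -lE -l'E; apply; apply: ind; exact: inc_tnth.
apply: (conj_mapP Mmonster sLam (@nthi _ s \o i) (@nthi _ s \o j)).1.
rewrite (map_comp (@nthi _ s) i) (map_comp (@nthi _ s) j).
by apply: H; rewrite ?size_map //; exact: inc_map_enum.
Qed.

Variable E : A -> A -> Prop.
Hypothesis Eequiv : type_definable_equivalence E.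

Lemma hclass_image (s : M -> M) (h h' : hyperimaginary E) x y :
  automorphism s -> hclass h = [set z | E x z] -> hclass h' = [set z | E y z] ->
  (fun z : A => s \o z) @` h = h' <-> E (s \o x) y.
Proof.
move=> aut_s -> ->; have [s' [aut_s' sK s'K]] := aut_inv aut_s; split=> [H|H].
  have : [set z | E y z] (s \o x) by rewrite -H; exists x => //; exact: E_refl.
  exact: E_sym.
apply/seteqP; split=> [_ [z xz <-]|z yz] /=.
  by apply: (E_trans Eequiv) (E_sym Eequiv H) _; exact: E_aut.
have ss (u : A) : s \o (s' \o u) = u by apply/funext => l; exact: s'K.
exists (s' \o z); last exact: ss.
have : E (s' \o (s \o x)) (s' \o z) by apply: E_aut => //; exact: E_trans H yz.
by rewrite (_ : s' \o (s \o x) = x) //; apply/funext => l; exact: sK.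
Qed.

Lemma Forall2_map_inv (X Y Z : Type) (r : X -> Y -> Prop) (f : Z -> X) (g : Z ->
  Y) l z :
  List.Forall2 r (map f l) (map g l) -> List.In z l -> r (f z) (g z).
Proof.
elim: l => //= w l IH H; inversion H; subst => -[<-//|]; exact: IH.
Qed.

Lemma hconj_mapP n (f g : 'I_n -> A) :
  hconj E (map f (enum 'I_n)) (map g (enum 'I_n)) <->
  exists2 s, automorphism s & forall k, E (s \o f k) (g k).
Proof.
split=> -[s aut_s H]; exists s => //.
  move=> k; rewrite /act -map_comp in H; apply: (Forall2_map_inv (z := k) H).
  by apply/In_mem; rewrite mem_enum.
by rewrite /act -map_comp; apply: Forall2_map => k _; exact: H.
Qed.

(** Any choice [r] of representatives is allowed, so the sequence (a_i) together with chosen members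
    of the filling classes can be used. *)
Lemma hindiscernibleP (s : oseq (hyperimaginary E)) (r : idx s -> A) :
  (forall x, hclass (nthi x) = [set z | E (r x) z]) ->
  hindiscernible s <->
  forall l l' : seq (idx s), inc l -> inc l' -> size l = size l' ->
  hconj E (map r l) (map r l').
Proof.
move=> rE; split=> [ind l l' il il' ll'|H n i j ii ij].
  pose t : (size l').-tuple _ := Tuple (introT eqP ll').
  have lE : l = map (tnth t) (enum 'I_(size l')) by rewrite map_tnth_enum.
  have l'E : l' = map (tnth (in_tuple l')) (enum 'I_(size l')).
    by rewrite map_tnth_enum.
  have [_] := hconj_mapP (r \o tnth t) (r \o tnth (in_tuple l')).
  rewrite (map_comp r (tnth t)) (map_comp r (tnth (in_tuple l'))) -lE -l'E;
    apply.
  have it : inc t by []; have it' : inc (in_tuple l') by [].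
  have [s' [aut_s' _ Hs]] := ind _ _ _ (inc_tnth it) (inc_tnth it').
  by exists s' => // k; exact: (hclass_image aut_s' (rE _) (rE _)).1 (Hs k).
have := H _ _ (inc_map_enum ii) (inc_map_enum ij); rewrite !size_map =>
  /(_ erefl).
rewrite -(map_comp r i) -(map_comp r j) => /hconj_mapP[s' aut_s' Hs].
by exists s'; split=> // k; exact: (hclass_image aut_s' (rE _) (rE _)).2 (Hs k).
Qed.

End Indiscernible.

Section Distal.
Variables (L : language) (T : theory L) (K : Type) (M : structure L).
Hypotheses (TNIP : NIP T) (Mmonster : monster T K M).
Variable Lam : Type.
Hypothesis sLam : small K [set: Lam].
Local Notation A := (Lam -> M).
Variable E : A -> A -> Prop.
Hypothesis Eequiv : type_definable_equivalence E.

Theorem distal_hyper (d : Order.disp_t) (I : orderType d) (a : I -> A) :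
  small K [set: I] -> distal_seq (@indiscernible L M Lam) (oseq_of a) ->
  distal_seq (@hindiscernible L M Lam E) (oseq_of (fun i => hyper E (a i))).
Proof.
move=> sI [/(indiscernibleP Mmonster sLam) ind dist].
have aindisc (l l' : seq I) : srt l -> srt l' -> size l = size l' ->
    conj (map a l) (map a l').
  by move=> sl sl'; apply: ind; rewrite inc_oseq_of.
split.
  apply: (hindiscernibleP Eequiv (s := oseq_of (fun i => hyper E (a i))) (r :=
    a)
    (fun=> erefl)).2 => l l' il il' ll'.
  by apply/(conj_hconj Eequiv)/ind; rewrite ?inc_oseq_of // -(inc_oseq_of (fun i
    => hyper E (a i))).
move=> D1 D2 cD1 cD2 ltD h h' fh fh'; have [D12 D21] := ltD.
have [iD1 uD1 dD1] := dedekind_cutP cD1; have [iD2 uD2 dD2] :=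
  dedekind_cutP cD2.
have D12x : exists2 c, D2 c & ~ D1 c.
  apply: contrapT => nc; apply: D21 => x D2x; apply: contrapT => D1x.
  by apply: nc; exists x.
have [al alE] := hclassP h; have [be beE] := hclassP h'.
pose fab (u : bool) : A := if u then al else be.
have fill D (u : bool) g : openup D -> hclass g = [set z | E (fab u) z] ->
    fills (@hindiscernible L M Lam E) (s := oseq_of (fun i =>
      hyper E (a i))) D g ->
    forall l1 l2, srt l1 -> srt l2 -> inset l1 D -> inset l2 (~` D) ->
    hEMseq E a (map a l1 ++ fab u :: map a l2).
  move=> uD gE fg.
  have rE (x : idx (oseq3 (fun i => hyper E (a i)) D g)) :
      hclass (nthi x) = [set z | E (pair_env a fab (code3 u x)) z].
    by case: x => [i|[[]|i]].
  have H := (hindiscernibleP Eequiv (s := oseq3 (fun i => hyper E (a i)) D g)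
    (r := pair_env a fab \o code3 u) rE).1 fg.
  move=> l1 l2 s1 s2 i1 i2; have [l il lE] := inc_code3 (fun i =>
    hyper E (a i)) g u s1 s2 i1 i2.
  (* [D] contains increasing lists of every length; one as long as [l] avoids the filling and
     witnesses goodness. *)
  have [|k [sk zk ik _]] := openup_chain (l := [::]) (size l) uD; first by [].
  have [k' ik' k'E] := inc_code3_left (fun i => hyper E (a i)) g u sk ik.
  exists k => //.
  have := H k' l ik' il; rewrite !(map_comp _ (code3 u)) lE k'E map_cat /=
    -!map_comp.
  apply.
  by rewrite -zk -(size_map (@code3 _ _ _ _ D g u)) k'E size_map.
have rE (x : idx (oseq5 (fun i => hyper E (a i)) D1 D2 h h')) :
    hclass (nthi x) = [set z | E (pair_env a fab (code5 x)) z].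
  by case: x => [i|[[]|[i|[[]|i]]]].
apply: (hindiscernibleP Eequiv (s := oseq5 (fun i => hyper E (a i)) D1 D2 h h')
  (r := pair_env a fab \o @code5 _ _ _ _ D1 D2 h h') rE).2.
suff H k : admissible D1 D2 k -> hEMseq E a (map (pair_env a fab) (tl k)).
  move=> l l' il il' ll'; have [k /H Rk kl] := code5_inc il.
  have [k' /H Rk' kl'] := code5_inc il'.
  apply: (hEMseq_hconj Eequiv aindisc); last by rewrite !size_map.
    by rewrite map_comp; apply: hEMseq_sub Rk; exact: sublist_map.
  by rewrite map_comp; apply: hEMseq_sub Rk'; exact: sublist_map.
apply: (distal_lift TNIP Mmonster sLam Eequiv sI aindisc iD1 iD2 D12 D12x uD1
  dD1 uD2 dD2).
- exact: fill fh.
- exact: fill fh'.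
move=> f f1 f2 {}k ak.
have rfill D u : (forall l1 l2, srt l1 -> srt l2 -> inset l1 D ->
  inset l2 (~` D) ->
      EMseq a (map a l1 ++ f u :: map a l2)) ->
    fills (@indiscernible L M Lam) (s := oseq_of a) D (f u).
  move=> H; apply/(indiscernibleP Mmonster sLam) => l l' il il' ll'.
  have nE : (@nthi _ (oseq3 a D (f u))) = pair_env a f \o @code3 _ _ _ a D (f u)
    u.
    by apply/funext => -[i|[[]|i]].
  suff HH m : inc m -> EMseq a (map (@nthi _ (oseq3 a D (f u))) m).
    by apply: (EMseq_conj aindisc (HH _ il) (HH _ il')); rewrite !size_map.
  move=> im; have [l1 [l2 [s1 s2 i1 i2 sub]]] := code3_inc u im.
  rewrite nE map_comp; apply: EMseq_sub (H _ _ s1 s2 i1 i2).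
  by have := sublist_map (pair_env a f) sub; rewrite map_cat /= -!map_comp.
have := dist D1 D2 cD1 cD2 ltD _ _ (rfill _ _ f1) (rfill _ _ f2).
move=> /(indiscernibleP Mmonster sLam) H.
have nE : (@nthi _ (oseq5 a D1 D2 (f true) (f false))) =
    pair_env a f \o @code5 _ _ _ a D1 D2 (f true) (f false).
  by apply/funext => -[i|[[]|[i|[[]|i]]]].
have [l il lE] := inc_code5 a (f true) (f false) ak.
have [|m [sm zm im _]] := openup_chain (l := [::]) (size l) uD1; first by [].
have [m' im' m'E] := inc_code5_left a D2 (f true) (f false) sm im.
exists m => //.
pose cf := @code5 _ _ _ a D1 D2 (f true) (f false).
suff : conj (map (pair_env a f) (map cf m')) (map (pair_env a f) (map cf l)).
  by rewrite lE m'E -map_comp.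
rewrite -2!(map_comp (pair_env a f)) -nE; apply: H => //.
by rewrite -zm -(size_map (@code5 _ _ _ a D1 D2 (f true) (f false))) m'E
  size_map.
Qed.

End Distal.

(** * Ramsey's theorem and lifting of hyperimaginaries *)

Definition strict (f : nat -> nat) := forall i j, i < j -> f i < f j.

Lemma strictS f : (forall i, f i < f i.+1) -> strict f.
Proof. by move=> H i j; apply: (homo_ltn ltn_trans). Qed.

Lemma strict_sorted f l : strict f -> sorted ltn l -> sorted ltn (map f l).
Proof. by move=> H; apply: homo_sorted. Qed.

Lemma strict_reflect f i j : strict f -> f i < f j -> i < j.
Proof.
move=> H fij; rewrite ltnNge leq_eqVlt; apply/negP => /orP[/eqP ji|/H].
  by rewrite ji ltnn in fij.
by move=> /(ltn_trans fij); rewrite ltnn.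
Qed.

Lemma bool_subsequence (c : nat -> bool) : exists k b, strict k /\
  forall i, c (k i) = b.
Proof.
have [H|/existsNP[N HN]] := pselect (forall N, exists i, N < i /\ c i).
  have [g Hg] := choice H.
  exists (fun i => iter i.+1 g 0), true; split; last by move=> i; exact:
    (Hg _).2.
  by apply: strictS => i /=; exact: (Hg _).1.
exists (fun i => N + i.+1), false; split=> [i j ij|i];
  first by rewrite ltn_add2l.
apply/negP => ci; apply: HN; exists (N + i.+1); split=> //.
by rewrite addnS ltnS leq_addr.
Qed.

(** Successive thinnings make the colour of an increasing list depend on its least element only; a
    last thinning makes it constant. *)
Lemma ramsey n (P : seq nat -> Prop) : exists f b, strict f /\
  forall l, sorted ltn l -> size l = n -> P (map f l) <-> is_true b.
Proof.
elim: n P => [|n IH] P.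
  exists id, `[< P [::] >]; split=> // -[] // _ _.
  by split=> /asboolP.
have /choice[g Hg] : forall F : nat -> nat, exists g : (nat -> nat) * bool,
    strict g.1 /\ forall l, sorted ltn l -> size l = n ->
    P (F 0 :: map (F \o S \o g.1) l) <-> is_true g.2.
  move=> F; have [g [b [sg Hg]]] := IH (fun l => P (F 0 :: map (F \o S) l)).
  by exists (g, b); split=> // l sl zl; rewrite -(Hg l sl zl) -map_comp.
(* [step F] drops the first point of [F] and thins out the rest until all lists starting with [F 0]
   have one colour; the first points of the successive stages form the sequence [a]. *)
pose step F := F \o S \o (g F).1.
pose Fs i := iter i step id.
have FsS i : Fs i.+1 = Fs i \o S \o (g (Fs i)).1 by [].
have sFs i : strict (Fs i).
  elim: i => [//|i IHi] x y xy; rewrite FsS /=; apply: IHi; rewrite ltnS.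
  by apply: (Hg _).1.
pose a i := Fs i 0.
have sa : strict a by apply: strictS => i; rewrite /a FsS /=; exact: sFs.
have tail i j : i <= j -> exists x, a j = Fs i x.
  move=> ij; rewrite -(subnK ij); elim: (j - i) {ij} => [|m [x _]].
    by exists 0.
  suff H k : exists h : nat -> nat, Fs (k + i) = Fs i \o h.
    by have [h hE] := H m.+1; exists (h 0); rewrite /a hE.
  elim: k => [|k [h hE]]; first by exists id.
  by exists (h \o S \o (g (Fs (k + i))).1); rewrite addSn FsS hE.
have color i l : sorted ltn (i :: l) -> size l = n ->
    P (map a (i :: l)) <-> is_true (g (Fs i)).2.
  move=> /= sl zl; have il := order_path_min ltn_trans sl.
  have [l' l'E] : exists l', map a l = map (Fs i.+1) l'.
    elim: l il {sl zl} => [|j l IHl] /=; first by exists [::].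
    move=> /andP[ij /IHl[l' ->]]; have [x ->] := tail i.+1 j ij.
    by exists (x :: l').
  rewrite l'E FsS; apply: (Hg (Fs i)).2; last first.
    by rewrite -zl -(size_map a l) l'E size_map.
  have : sorted ltn (map a l) by apply: strict_sorted (path_sorted sl).
  by rewrite l'E sorted_map; apply: sub_sorted => x y; exact:
    (strict_reflect (sFs i.+1)).
have [k [b [sk Hk]]] := bool_subsequence (fun i => (g (Fs i)).2).
exists (a \o k), b; split; first by move=> i j /sk/sa.
move=> [//|i l] sl [zl]; rewrite map_comp /= color ?size_map ?Hk //.
exact: (strict_sorted sk sl).
Qed.

Lemma ramsey_seq (X : Type) (s : seq X) (n : X -> nat) (P : X -> seq nat ->
  Prop) :
  exists f, strict f /\ forall x, List.In x s ->
    exists b, forall l, sorted ltn l ->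
    size l = n x -> P x (map f l) <-> is_true b.
Proof.
elim: s => [|x s [f [sf Hf]]]; first by exists id; split=> // x [].
have [g [b [sg Hg]]] := ramsey (n x) (fun l => P x (map f l)).
exists (f \o g); split=> [i j /sg/sf//|y [<-|ys]].
  by exists b => l sl zl; rewrite map_comp Hg.
have [c Hc] := Hf y ys; exists c => l sl zl; rewrite map_comp Hc ?size_map //.
exact: strict_sorted.
Qed.

Section Lift.
Variables (L : language) (T : theory L) (K : Type) (M : structure L).
Hypothesis Mmonster : monster T K M.
Variable Lam : Type.
Hypothesis sLam : small K [set: Lam].
Local Notation A := (Lam -> M).
Variable E : A -> A -> Prop.
Hypothesis Eequiv : type_definable_equivalence E.
Variables (d : Order.disp_t) (I : orderType d).

Lemma srt_index (u l : seq I) : srt u -> srt l -> {subset l <= u} ->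
  sorted ltn [seq index x u | x <- l].
Proof.
rewrite !srtE => su sl lu; rewrite sorted_map.
apply: (sub_in_sorted (P := mem u)) sl; last by apply/allP => x /lu.
move=> x y xu yu xy /=; rewrite ltnNge leq_eqVlt; apply/negP => /orP[/eqP e|].
  by move: xy; rewrite -(nth_index x yu) e nth_index // ltxx.
move=> /(sorted_ltn_index lt_trans su _ _ yu xu) /(lt_trans xy).
by rewrite ltxx.
Qed.

(** By compactness it suffices to be homogeneous for finitely many formulas on finitely many
    indices. Ramsey's theorem finds such homogeneous representatives along [q], and indiscernibility
    of the classes transports them, up to [E], to any increasing list of the same length. *)
Lemma hindiscernible_lift (r : I -> A) (q : nat -> I) : small K [set: I] ->
  (forall i j, i < j -> (q i < q j)%O) ->
  (forall l l', srt l -> srt l' -> size l = size l' ->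
     hconj E (map r l) (map r l')) ->
  exists2 a : I -> A, forall i, E (r i) (a i) & indiscernible (oseq_of a).
Proof.
move=> sI sq hr.
pose J2 := {n & (n.-tuple I * n.-tuple I * formula L ('I_n * Lam))%type}.
pose ev (e : I -> A) n (l : n.-tuple I) (v : 'I_n * Lam) := e (tnth l v.1) v.2.
(* One implication is enough, since the two lists can be exchanged. *)
pose C2 (x : J2) (e : I -> A) := let: existT n (l, l', p) := x in
  srt l -> srt l' -> sat p (ev e n l) -> sat p (ev e n l').
pose C (j : I + J2) (e : I + I -> A) := match j with
  | inl i => E (e (inl i)) (e (inr i))
  | inr x => C2 x (e \o inr) end.
have [||a Ha] := tcompact (C := C) (e0 := r) Mmonster sLam sI sI.
- move=> [i|[n [[l l'] p]]]; first exact: tclosed_E.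
  do 2 apply: tclosed_forall => ?; apply: tclosed_tdefinable.
  pose rl (k : n.-tuple I) (v : 'I_n * Lam) : (I + I) * Lam :=
    (inr (tnth k v.1), v.2).
  exact: definable_imp (definable_rename (rl l) (definable_sat M p))
                       (definable_rename (rl l') (definable_sat M p)).
- move=> s.
  pose covers (u : seq I) (j : I + J2) : Prop := match j with
    | inl i => is_true (i \in u)
    | inr (existT n (l, l', p)) => srt l -> srt l' ->
        {subset l <= u} /\ {subset l' <= u} end.
  have [u su Hu] : exists2 u, srt u & forall j, List.In j s -> covers u j.
    elim: s => [|j s [u su Hu]]; first by exists [::].
    have add v : srt v -> exists2 w, srt w & {subset v <= w} /\
        forall j, List.In j s -> covers w j.
      move=> sv; have [w [sw vw uw _]] := srt_merge sv su.
      exists w => //; split=> // -[i /Hu/uw//|[n [[l l'] p]] /Hu H sl sl'].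
      by have [H1 H2] := H sl sl'; split=> x /[dup] => [_ /H1/uw|_ /H2/uw].
    case: j => [i|[n [[l l'] p]]].
      have [w sw [iw Hw]] := add [:: i] isT.
      by exists w => // j [<-|/Hw//]; apply: iw; rewrite inE.
    have [sl|nsl] := boolP (srt l); last first.
      exists u => // j [<- sl|/Hu//]; by rewrite sl in nsl.
    have [sl'|nsl'] := boolP (srt l'); last first.
      exists u => // j [<- _ sl'|/Hu//]; by rewrite sl' in nsl'.
    have [v [sv lv l'v _]] := srt_merge sl sl'.
    have [w sw [vw Hw]] := add v sv.
    by exists w => // j [<- _ _|/Hw//]; split=> x => [/lv/vw|/l'v/vw].
  pose P (x : J2) (l : seq nat) := let: existT n (_, _, p) := x in
    sat p (fun v => r (q (nth 0 l v.1)) v.2).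
  have [f [sf Hf]] := ramsey_seq (pmap (fun j : I + J2 =>
    if j is inr x then Some x else None) s)
    (fun x : J2 => projT1 x) P.
  pose m := size u.
  have sqf : srt (map (q \o f) (iota 0 m)).
    rewrite srtE; apply: homo_sorted (iota_ltn_sorted 0 m) => i j ij.
    exact/sq/sf.
  (* The homogeneous tuples are moved onto [u]: their images [z] lie in the classes of [r] there
     and, being conjugates, remain homogeneous. *)
  have [|z [t aut_t zE] zu] := hconj_lift (hr _ _ sqf su _).
    by rewrite size_map size_iota.
  have [x0] := dom_inhabited M; pose b : A := fun=> x0.
  have zz : size z = m by rewrite (Forall2_size zu) size_map.
  pose g i := nth b z (index i u).
  have gE i : i \in u -> g i = t \o r (q (f (index i u))).
    move=> iu; have im : index i u < m by rewrite index_mem.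
    rewrite /g zE /act -!map_comp (nth_map 0) ?size_iota //=.
    by rewrite nth_iota.
  exists g => -[i|[n [[l l'] p]]] js /=.
    have iu := Hu _ js; rewrite -{1}(nth_index i iu).
    apply: (E_sym Eequiv).
    have := @Forall2_nth _ _ _ b b _ _ (index i u) zu.
    by rewrite (nth_map i) ?index_mem // zz index_mem; apply.
  move=> sl sl'; have [lu l'u] := Hu _ js sl sl'.
  have [|c Hc] := Hf (existT _ n (l, l', p)); first exact: In_pmap js erefl.
  have key (k : n.-tuple I) : srt k -> {subset k <= u} ->
      sat p (ev g n k) <-> is_true c.
    move=> sk ku.
    have := Hc [seq index x u | x <- k]; rewrite size_map size_tuple.
    move=> /(_ (srt_index su sk ku) erefl) <- /=.
    rewrite -[X in _ <-> X](sat_aut aut_t).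
    have -> : ev g n k = t \o (fun v : 'I_n * Lam =>
        r (q (nth 0 (map f [seq index x u | x <- k]) v.1)) v.2); last by [].
    apply/funext => -[j lam]; rewrite /ev /= gE; last exact/ku/mem_tnth.
    rewrite /= (nth_map 0) ?size_map ?size_tuple ?ltn_ord //.
    rewrite (nth_map (tnth k j)) ?size_tuple ?ltn_ord //.
    by rewrite -tnth_nth.
  by move=> /(key l sl lu) H; apply/key.
exists a => [i|]; first exact: (Ha (inl i)).
move=> n i j ii ij p.
pose ti := [tuple i k | k < n]; pose tj := [tuple j k | k < n].
have si : srt ti by rewrite -(inc_oseq_of a); exact: inc_map_enum.
have sj : srt tj by rewrite -(inc_oseq_of a); exact: inc_map_enum.
have evE (k : 'I_n -> I) : ev a n [tuple k x | x < n] = fun v => a (k v.1) v.2.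
  by apply/funext => v; rewrite /ev tnth_mktuple.
have := Ha (inr (existT _ n (ti, tj, p))) si sj.
have := Ha (inr (existT _ n (tj, ti, p))) sj si.
by rewrite /C /C2 !(evE i) !(evE j) => H1 H2; split.
Qed.

End Lift.

Theorem theorem3p24 (L : language) (T : theory L) (K : Type) (M : structure L)
    (Tcomplete : complete T) (TNIP : NIP T) (Mmonster : monster T K M) :
  (forall (Lam : Type) (E : (Lam -> M) -> (Lam -> M) -> Prop),
     small K [set: Lam] -> type_definable_equivalence E ->
   forall (d : Order.disp_t) (I : orderType d) (a : I -> Lam -> M),
     small K [set: I] -> dense_order I ->
     distal_seq (@indiscernible L M Lam) (oseq_of a) ->
     distal_seq (@hindiscernible L M Lam E)
                (oseq_of (fun i => hyper E (a i))))
  /\ (distal_theory M K -> heq_distal M K).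
Proof.
have part1 (Lam : Type) (E : (Lam -> M) -> (Lam -> M) -> Prop) :=
  @distal_hyper L T K M TNIP Mmonster Lam ^~ E.
split=> [Lam E sLam Eequiv d I a sI _|distT Lam E sLam Eequiv d I h sI dI indh].
  exact: part1.
split=> // D1 D2 cD1 cD2 ltD.
(* The lift is made only once a cut is given: its left half has no last element, and climbing in it
   yields the increasing sequence to which Ramsey's theorem is applied. *)
have [iD1 [[x0 Dx0] up] _] := dedekind_cutP cD1.
have [q Hq] : exists q : nat -> I, forall i j, i < j -> (q i < q j)%O.
  have /choice[g Hg] : forall x, exists y, D1 x -> D1 y /\ (x < y)%O.
    move=> x; have [/up[y Dy xy]|nD] := pselect (D1 x); last by exists x0.
    by exists y.
  have Dg i : D1 (iter i g x0) by elim: i => //= i /Hg[].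
  exists (fun i => iter i g x0); apply: (homo_ltn (@lt_trans _ I)).
  by move=> i; exact: (Hg _ (Dg i)).2.
have /choice[r Hr] := fun i => hclassP (h i).
have /(hindiscernibleP Eequiv (s := oseq_of h) Hr) Hh := indh.
have [|a ra inda] := hindiscernible_lift Mmonster sLam Eequiv (r := r) sI Hq.
  by move=> l l' sl sl'; apply: Hh; rewrite inc_oseq_of.
have hE : h = fun i => hyper E (a i).
  apply/funext => i; case: (h i) (Hr i) => c cP /= cE.
  have {cE} cE : c = [set b | E (a i) b].
    rewrite cE; apply/seteqP; split=> b /= ab.
      by apply: (E_trans Eequiv) ab; exact/(E_sym Eequiv)/ra.
    exact: (E_trans Eequiv) (ra i) ab.
  rewrite cE in cP *; rewrite /hyper; congr Hyperimaginary.
  exact: Prop_irrelevance.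
have [_] := part1 Lam E sLam Eequiv d I a sI (distT Lam sLam d I a sI dI inda).
by rewrite -hE; apply.
Qed.
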